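(* Let $N\ge 1$, let $p_c:=\frac{2N}{N+1}<p\le 2$ and $0<q<p-1$. Let $u_0\in W^{1,\infty}(\mathbb{R}^N)$ satisfy $u_0\ge 0$, $u_0\not\equiv 0$, and $$u_0(x)\le C(1+|x|)^{-\theta},\qquad x\in\mathbb{R}^N,$$ for some $C>0$ and some $\theta>\frac{q}{1-q}$. Let $u$ be the solution to $\partial_t u-\Delta_p u+|\nabla u|^q=0$ in $(0,\infty)\times\mathbb{R}^N$ with $u(0)=u_0$, and let $\mathcal{P}(t):=\{x\in\mathbb{R}^N:\ u(t,x)>0\}$ for $t\ge 0$. Then: (i) (Instantaneous shrinking) for any $t>0$, $\mathcal{P}(t)$ is a bounded subset of $\mathbb{R}^N$; (ii) (Localization) for any $\tau>0$ there exists $\varrho_\tau>0$ such that $\mathcal{P}(t)\subseteq B(0,\varrho_\tau)$ for all $t\ge\tau$; (iii) (Extinction) there is $T_e>0$ such that $u(t)\equiv 0$ for all $t\ge T_e$.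
   Context: $\Delta_p u=\mathrm{div}(|\nabla u|^{p-2}\nabla u)$. For $p\in(p_c,2]$, $q>0$ and $u_0\in W^{1,\infty}(\mathbb{R}^N)$ with $u_0\ge0$, $u_0\not\equiv0$, it is known that the Cauchy problem $\partial_t u-\Delta_p u+|\nabla u|^q=0$ in $(0,\infty)\times\mathbb{R}^N$, $u(0)=u_0$, has a unique nonnegative viscosity solution $u\in\mathcal{BC}([0,\infty)\times\mathbb{R}^N)\cap L^\infty(0,\infty;W^{1,\infty}(\mathbb{R}^N))$ ($\mathcal{BC}$: bounded continuous functions), which is also a weak solution if $p<2$ and a classical solution if $p=2$, and satisfies $0\le u\le\|u_0\|_\infty$. ''The solution'' means this one. $B(x,r)$ denotes the ball of center $x$ and radius $r$. *)

(* Defs.v *)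
From HB Require Import structures.
From mathcomp Require Import all_boot all_order all_algebra.
From mathcomp Require Import all_classical all_reals all_analysis.
Set Implicit Arguments.
Unset Strict Implicit.
Unset Printing Implicit Defensive.
Import Order.TTheory GRing.Theory Num.Theory.
Import numFieldNormedType.Exports.
Local Open Scope classical_set_scope.
Local Open Scope ring_scope.

(* The norm that the library puts on row vectors is the sup norm; [enorm] is
   the Euclidean one. *)
Definition enorm (R : realType) (N : nat) (x : 'rV[R]_N) : R :=
  Num.sqrt (\sum_(i < N) x 0 i ^+ 2).

Definition eball (R : realType) (N : nat) (x : 'rV[R]_N) (r : R) :
  set 'rV[R]_N := [set y | enorm (y - x) < r].

Definition basis_vec (R : realType) (N : nat) (i : 'I_N) : 'rV[R]_N :=
  delta_mx 0 i.

Definition grad (R : realType) (N : nat) (f : 'rV[R]_N -> R) (x : 'rV[R]_N) :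
  'rV[R]_N := \row_i 'D_(basis_vec R i) f x.

Definition divergence (R : realType) (N : nat) (F : 'rV[R]_N -> 'rV[R]_N)
  (x : 'rV[R]_N) : R := \sum_i 'D_(basis_vec R i) (fun y => F y 0 i) x.

(* For p = 2 this is the Laplacian everywhere, since [powR] satisfies
   0 `^ 0 = 1. For p < 2 it is only used at points where the gradient does not
   vanish. *)
Definition plap (R : realType) (N : nat) (p : R) (f : 'rV[R]_N -> R) :
  'rV[R]_N -> R :=
  divergence (fun y => enorm (grad f y) `^ (p - 2) *: grad f y).

(* Functions of class C^k on an open subset O of a finite-dimensional space:
   all iterated directional derivatives up to order k exist and are continuous
   on O. *)
Fixpoint Ck_on (R : realType) (V : normedModType R) (k : nat) (O : set V)
    (f : V -> R) : Prop :=
  (forall z, O z -> {for z, continuous f}) /\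
  match k with
  | 0%N => True
  | k'.+1 => forall v, (forall z, O z -> derivable f z v) /\
                       Ck_on k' O ('D_v f)
  end.

(* The library has no Lebesgue measure on R^N. It is built here on the
   measurable space of N-tuples of reals, by induction on N: a Dirac mass when
   N = 0, and the image of lebesgue_measure \x lebN N' under (x, y) |-> x :: y
   when N = N'.+1. The induction also carries sigma-finiteness. *)
Section LebesgueN.
Context {R : realType}.
Local Notation T := (measurableTypeR R).

Definition tcons (n : nat) (z : T * n.-tuple T) : n.+1.-tuple T :=
  [the n.+1.-tuple T of z.1 :: z.2].

Lemma measurable_tcons (n : nat) : measurable_fun setT (@tcons n).
Proof. exact: measurable_cons. Qed.

Section step.
Context (n : nat) (mu : {sigma_finite_measure set (n.-tuple T) -> \bar R}).

Definition leb_step : set (n.+1.-tuple T) -> \bar R :=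
  pushforward ((@lebesgue_measure R) \x mu)%E (@tcons n).

HB.instance Definition _ := Measure.copy leb_step
  (measure_function_pushforward__canonical__measure_function_Measure
     ((@lebesgue_measure R) \x mu)%E (@measurable_tcons n)).

Lemma leb_step_sigma_finite : sigma_finite setT leb_step.
Proof.
have /sigma_finiteP[F [TF ndF Foo]] := sigma_finiteT (@lebesgue_measure R).
have /sigma_finiteP[G [TG ndG Goo]] := sigma_finiteT mu.
pose g (t : n.+1.-tuple T) : T * n.-tuple T := (tnth t ord0, [tuple of behead t]).
have gK z : g (tcons z) = z.
  by case: z => x y; congr pair; exact: val_inj.
have mg : measurable_fun setT g.
  by apply/measurable_fun_pairP; split; [exact: measurable_tnth|
    exact: measurable_behead].
exists (fun k => g @^-1` (F k `*` G k)).
  rewrite -preimage_bigcup -[LHS](preimage_setT g); congr (_ @^-1` _).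
  rewrite -setXTT TF TG predeqE => -[x y]; split.
    move=> [/= [m _ Fmx] [k _ Gky]]; exists (maxn m k) => //; split.
    - by move: x Fmx; exact/subsetPset/ndF/leq_maxl.
    - by move: y Gky; exact/subsetPset/ndG/leq_maxr.
  by move=> [m _ []/= ? ?]; split; exists m.
move=> k; have [mF Fk] := Foo k; have [mG Gk] := Goo k; split.
  by rewrite -[X in measurable X]setTI; apply: mg => //; exact: measurableX.
rewrite /leb_step /pushforward (_ : _ @^-1` _ = F k `*` G k).
  by rewrite product_measure1E// lte_mul_pinfty// ge0_fin_numE.
by rewrite -comp_preimage (_ : g \o _ = id)//; exact/funext/gK.
Qed.

HB.instance Definition _ :=
  Measure_isSigmaFinite.Build _ _ _ leb_step leb_step_sigma_finite.
End step.

Fixpoint lebN (n : nat) : {sigma_finite_measure set (n.-tuple T) -> \bar R} :=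
  match n with
  | 0%N => \d_([tuple] : 0.-tuple T)
  | n'.+1 => leb_step (lebN n')
  end.
End LebesgueN.

Definition row_of_tuple (R : realType) (N : nat) (t : N.-tuple (measurableTypeR R)) :
  'rV[R]_N := \row_i tnth t i.

Definition test_function (R : realType) (N : nat) (phi : 'rV[R]_N -> R) : Prop :=
  (forall k, Ck_on k [set: 'rV[R]_N] phi) /\
  compact (closure [set x | phi x != 0]).

Definition ess_bounded (R : realType) (N : nat) (f : 'rV[R]_N -> R) (M : R) : Prop :=
  measurable_fun setT (f \o @row_of_tuple R N) /\
  {ae lebN N, forall t, `|f (row_of_tuple t)| <= M}.

Definition weak_partial (R : realType) (N : nat) (i : 'I_N)
    (f g : 'rV[R]_N -> R) : Prop :=
  forall phi : 'rV[R]_N -> R, test_function phi ->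
    (\int[lebN N]_t (f (row_of_tuple t) *
                     'D_(basis_vec R i) phi (row_of_tuple t)) =
     - \int[lebN N]_t (g (row_of_tuple t) * phi (row_of_tuple t)))%R.

(* [W1oo_bounded f M]: f is in W^{1,oo}(R^N), and M bounds |f| and all the weak
   partial derivatives of f almost everywhere. *)
Definition W1oo_bounded (R : realType) (N : nat) (f : 'rV[R]_N -> R) (M : R) : Prop :=
  ess_bounded f M /\
  exists g : 'I_N -> 'rV[R]_N -> R,
    forall i, ess_bounded (g i) M /\ weak_partial i f (g i).

Definition W1oo (R : realType) (N : nat) (f : 'rV[R]_N -> R) : Prop :=
  exists M : R, W1oo_bounded f M.

Definition uncurried (R : realType) (N : nat) (f : R -> 'rV[R]_N -> R)
  (z : R * 'rV[R]_N) : R := f z.1 z.2.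

Definition Qoo (R : realType) (N : nat) : set (R * 'rV[R]_N) :=
  [set z | 0 < z.1].

(* Since the operator is singular at critical points when p < 2, viscosity
   solutions are understood in the sense of Ohnuma and Sato: test functions
   are flat enough at their critical points, as measured by the class
   [flat_class]. An f in C^2([0,oo)) with f(0) = f'(0) = f''(0) = 0 is here
   extended by 0 to a C^2 function on the whole line. *)
Definition flat_class (R : realType) (p : R) (f : R -> R) : Prop :=
  [/\ Ck_on 2 [set: R] f,
      [/\ f 0 = 0, derive1 f 0 = 0 & derive1n 2 f 0 = 0],
      (forall r, 0 < r -> 0 < derive1n 2 f r) &
      `|derive1 f r| `^ (p - 2) * derive1n 2 f r @[r --> 0^'+] --> (0 : R)].

Definition modulus (R : realType) (w : R -> R) : Prop :=
  [/\ {within [set r : R | 0 <= r], continuous w},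
      (forall r, 0 <= r -> 0 <= w r) &
      w r / r @[r --> 0^'+] --> (0 : R)].

Definition admissible (R : realType) (N : nat) (p : R)
    (psi : R -> 'rV[R]_N -> R) : Prop :=
  Ck_on 2 (@Qoo R N) (uncurried psi) /\
  (p < 2 -> forall t0 x0, 0 < t0 -> grad (psi t0) x0 = 0 ->
    exists delta f w, [/\ 0 < delta, flat_class p f, modulus w &
      forall t x, 0 < t -> enorm (x - x0) + `|t - t0| < delta ->
        `|psi t x - psi t0 x0 - derive1 (psi^~ x0) t0 * (t - t0)|
          <= f (enorm (x - x0)) + w `|t - t0|]).

(* The right-hand side of  d_t psi = Delta_p psi - |grad psi|^q  at (t, x),
   where Delta_p psi is read as 0 at critical points when p < 2. *)
Definition visc_rhs (R : realType) (N : nat) (p q : R)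
    (phi : 'rV[R]_N -> R) (x : 'rV[R]_N) : R :=
  if (p < 2) && (grad phi x == 0) then 0
  else plap p phi x - enorm (grad phi x) `^ q.

Definition visc_subsolution (R : realType) (N : nat) (p q : R)
    (u : R -> 'rV[R]_N -> R) : Prop :=
  forall psi t0 x0, admissible p psi -> 0 < t0 ->
    (forall t x, 0 < t -> u t x - psi t x <= u t0 x0 - psi t0 x0) ->
    derive1 (psi^~ x0) t0 <= visc_rhs p q (psi t0) x0.

Definition visc_supersolution (R : realType) (N : nat) (p q : R)
    (u : R -> 'rV[R]_N -> R) : Prop :=
  forall psi t0 x0, admissible p psi -> 0 < t0 ->
    (forall t x, 0 < t -> u t0 x0 - psi t0 x0 <= u t x - psi t x) ->
    visc_rhs p q (psi t0) x0 <= derive1 (psi^~ x0) t0.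

(* Semicontinuity is not part of the two previous definitions, as they are only
   used for functions that are continuous. *)
Record solution (R : realType) (N : nat) (p q : R) (u0 : 'rV[R]_N -> R)
    (u : R -> 'rV[R]_N -> R) : Prop := Solution {
  sol_continuous :
    {within [set z : R * 'rV[R]_N | 0 <= z.1], continuous (uncurried u)} ;
  sol_bounded : exists M, forall t x, 0 <= t -> `|u t x| <= M ;
  sol_W1oo : exists M,
    {ae @lebesgue_measure R, forall t, 0 < t -> W1oo_bounded (u t) M} ;
  sol_ge0 : forall t x, 0 <= t -> 0 <= u t x ;
  sol_sub : visc_subsolution p q u ;
  sol_super : visc_supersolution p q u ;
  sol_init : forall x, u 0 x = u0 x }.

Definition positivity_set (R : realType) (N : nat) (u : R -> 'rV[R]_N -> R)
  (t : R) : set 'rV[R]_N := [set x | 0 < u t x].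

(* Main.v *)
From HB Require Import structures.
Require Import Defs.
From mathcomp Require Import all_boot all_order all_algebra.
From mathcomp Require Import all_classical all_reals all_analysis.
From mathcomp Require Import ring lra.
Import Order.TTheory GRing.Theory Num.Theory.
Import numFieldNormedType.Exports.
Local Open Scope classical_set_scope.
Local Open Scope ring_scope.
Set Implicit Arguments.
Unset Strict Implicit.
Unset Printing Implicit Defensive.

(** One explicit barrier gives all three assertions at once. Near infinity the
    solution is governed by the Hamilton-Jacobi equation
    u_t + |grad u|^q = 0, q < 1: a level u ~ r^(-theta) has slope
    ~ r^(-theta-1) and decreases at the rate r^(-(theta+1) q), which beats the
    level itself exactly when theta > q / (1 - q). This suggests the
    supersolution, for al = theta / n with n large and e a short vector,
<<
      M * max (profile al (e . x) - clock c t, 0) ^ n,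
>>
    where profile al s decays like s^(-al) and clock c t increases from 0 to 2.
    - If n (1 - q - q / theta) >= 1 the loss of height due to the clock is paid
      by half of the absorption term, provided c is small
      ([decay_le_absorption]).
    - If (n - 1) (p - 1 - q) >= 1 the singular diffusion at the free boundary is
      controlled by the absorption too, and scaling (|e| small) makes it smaller
      than the other half ([diffusion_le_absorption]); this is where q < p - 1
      enters.
    The barrier vanishes where profile al (e . x) <= clock c t. Choosing e
    parallel to x, it vanishes as soon as profile al (|e| |x| / 2) <= clock c t:
    a bounded set of x is left out for t > 0, this set shrinks with t, and it is
    empty once clock c t >= 1 = profile al 0 ([solution_eq0]).

    A planar barrier is used instead of a radial one because a radial decreasing
    function has a critical point at its maximum, where for p < 2 a viscosity
    subsolution only satisfies psi_t <= 0: a barrier that decreases in time is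
    not contradicted there. A planar function has no such point, but it is not
    coercive. So e . x is replaced by the concave quadratic polynomial e . x -
    ep |x|^2 / 2 ([paraboloid]), which tends to - oo in all directions, and
    whose only critical point is far away. Once a small number k1 has been
    subtracted from the profile, that point lies where the barrier is constant
    in x. The resulting function ([barrier]) is an admissible test function on
    the whole space ([barrier_admissible]): it is of class C^2, and it is flat
    at its critical points since there, up to an affine function of t, it
    vanishes to order n. A positive maximum of u - barrier, which exists by
    coercivity, contradicts the definition of a viscosity subsolution
    ([le_barrier]). One then lets ep, k1 and the coefficient of a linear term in
    t tend to 0. *)

(** * Directional derivatives and functions of class C^k *)

Lemma is_derive_dir (R : realType) (V : normedModType R) (f : V -> R)
    (x v : V) (d : R) :
  is_derive (0 : R) 1 (fun h : R => f (h *: v + x)) d -> is_derive x v f d.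
Proof.
move=> [D1 D2]; apply: DeriveDef; first exact: (iffRL (derivable1P _ _ _) D1).
rewrite -D2 /derive; set A := (fun h => _); set B := (fun h => _).
suff -> : A = B by [].
by apply/funext => s; rewrite /A/B/= addr0 scale0r add0r [_%:A]mulr1.
Qed.

(** No differentiability of f is needed for the chain rule along a line: only
    the restriction of f to the line through x directed by v matters. *)
Lemma is_derive_comp_dir (R : realType) (V : normedModType R) (h : R -> R)
    (f : V -> R) (x v : V) (df dh : R) :
  is_derive x v f df -> is_derive (f x) 1 h dh ->
  is_derive x v (h \o f) (dh * df).
Proof.
move=> [fx <-] hh.
pose g (s : R) := f (s *: v + x).
have quotE (F : V -> R) :
    (fun s : R => s^-1 *: (((fun r : R => F (r *: v + x)) \o shift 0) (s *: 1) -
       F (0 *: v + x))) =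
    (fun s : R => s^-1 *: ((F \o shift x) (s *: v) - F x)).
  by apply/funext => s /=; rewrite addr0 scale0r add0r [_%:A]mulr1.
have g0 : g 0 = f x by rewrite /g scale0r add0r.
have dg : is_derive (0 : R) 1 g ('D_v f x).
  apply: DeriveDef; first exact: (iffLR (derivable1P _ _ _) fx).
  by rewrite /derive /g quotE.
rewrite -g0 in hh.
exact: is_derive_dir (is_derive1_comp hh dg).
Qed.

Lemma Ck_on_weaken (R : realType) (V : normedModType R) k (O : set V)
  (f : V -> R) : Ck_on k.+1 O f -> Ck_on k O f.
Proof.
elim: k f => [f [cf _]//|k IH f [cf df]]; split => // v.
by have [d1 d2] := df v; split => //; exact: IH.
Qed.

Lemma Ck_on_subset (R : realType) (V : normedModType R) k (O O' : set V)
  (f : V -> R) : O' `<=` O -> Ck_on k O f -> Ck_on k O' f.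
Proof.
move=> sO; elim: k f => [|k IH] f [cf df]; split => //.
- by move=> z /sO; exact: cf.
- by move=> z /sO; exact: cf.
- by move=> v; have [d1 d2] := df v; split; [move=> z /sO; exact: d1|exact: IH].
Qed.

Lemma Ck_on_continuous (R : realType) (V : normedModType R) k (O : set V)
  (f : V -> R) : Ck_on k O f -> forall z, O z -> {for z, continuous f}.
Proof. by case: k => [|k] []. Qed.

(** Openness matters: the derivatives at a point of O only depend on f near that
    point. *)
Lemma Ck_on_ext (R : realType) (V : normedModType R) k (O : set V)
    (f g : V -> R) : open O -> (forall z, O z -> f z = g z) ->
  Ck_on k O f -> Ck_on k O g.
Proof.
move=> oO; elim: k f g => [|k IH] f g fg [cf df].
all: have nfg z : O z -> \near z, f z = g z
  by move=> Oz; near=> y; apply: fg; near: y; exact: open_nbhs_nbhs.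
all: have cg z : O z -> {for z, continuous g}.
1,3: move=> Oz; have cfz : f y @[y --> z] --> f z := cf z Oz.
1,2: suff : g y @[y --> z] --> f z by rewrite (fg z Oz).
1,2: by apply: cvg_trans cfz; exact/near_eq_cvg/nfg.
  by split.
split => // v; have [d1 d2] := df v; split.
  by move=> z Oz; exact: near_eq_derivable (nfg z Oz) (d1 z Oz).
by apply: IH d2 => z Oz; exact: near_eq_derive (nfg z Oz).
Unshelve. all: by end_near. Qed.

Lemma Ck_on_cst (R : realType) (V : normedModType R) k (O : set V) (a : R) :
  Ck_on k O (fun=> a).
Proof.
elim: k a => [|k IH] a; split => //; try by move=> z _; exact: cvg_cst.
move=> v; split => [z _|]; first exact: derivable_cst.
rewrite (_ : 'D_v _ = fun=> 0)//; apply/funext => z; exact: derive_cst.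
Qed.

Lemma Ck_on_add (R : realType) (V : normedModType R) k (O : set V)
    (f g : V -> R) : open O -> Ck_on k O f -> Ck_on k O g ->
  Ck_on k O (fun z => f z + g z).
Proof.
move=> oO; elim: k f g => [|k IH] f g.
  by move=> [cf _] [cg _]; split => // z Oz; apply: cvgD; [exact: cf|exact: cg].
move=> [cf df] [cg dg]; split.
  by move=> z Oz; apply: cvgD; [exact: cf|exact: cg].
move=> v; have [df1 df2] := df v; have [dg1 dg2] := dg v; split.
  by move=> z Oz; apply: derivableD; [exact: df1|exact: dg1].
apply: Ck_on_ext (IH _ _ df2 dg2) => // z Oz.
by rewrite -deriveD//; [exact: df1|exact: dg1].
Qed.

Lemma Ck_on_mul (R : realType) (V : normedModType R) k (O : set V)
    (f g : V -> R) : open O -> Ck_on k O f -> Ck_on k O g ->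
  Ck_on k O (fun z => f z * g z).
Proof.
move=> oO; elim: k f g => [|k IH] f g.
  by move=> [cf _] [cg _]; split => // z Oz; apply: cvgM; [exact: cf|exact: cg].
move=> /[dup] Cf [cf df] /[dup] Cg [cg dg]; split.
  by move=> z Oz; apply: cvgM; [exact: cf|exact: cg].
move=> v; have [df1 df2] := df v; have [dg1 dg2] := dg v; split.
  by move=> z Oz; apply: derivableM; [exact: df1|exact: dg1].
apply: (@Ck_on_ext _ _ _ _ (fun z => f z * 'D_v g z + g z * 'D_v f z)) => //.
  by move=> z Oz; rewrite deriveM//; [exact: df1|exact: dg1].
by apply: Ck_on_add => //; apply: IH => //; exact: Ck_on_weaken.
Qed.

Lemma Ck_on_comp (R : realType) (V : normedModType R) k (O : set V)
    (U : set R) (h : R -> R) (f : V -> R) : open O ->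
  (forall z, O z -> U (f z)) -> Ck_on k U h -> Ck_on k O f ->
  Ck_on k O (fun z => h (f z)).
Proof.
move=> oO OU; elim: k h f OU => [|k IH] h f OU.
  move=> [ch _] [cf _]; split => // z Oz.
  by apply: (continuous_comp (f:=f) (g:=h)); [exact: cf|exact: ch (OU _ Oz)].
move=> [ch dh] /[dup] Cf [cf df]; split.
  by move=> z Oz; apply: (continuous_comp (f:=f) (g:=h)); [exact: cf|exact: ch (OU _ Oz)].
move=> v; have [df1 df2] := df v; have [dh1 dh2] := dh 1.
have D z : O z -> is_derive z v (h \o f) ('D_1 h (f z) * 'D_v f z).
  by move=> Oz; apply: is_derive_comp_dir; apply: derivableP;
    [exact: df1|exact: dh1 (OU _ Oz)].
split; first by move=> z /D[].
apply: (@Ck_on_ext _ _ _ _ (fun z => 'D_1 h (f z) * 'D_v f z)) => //.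
  by move=> z /D[_ <-].
by apply: Ck_on_mul => //; exact: (IH ('D_1 h) f OU dh2 (Ck_on_weaken Cf)).
Qed.

Lemma Ck_on_sum (R : realType) (V : normedModType R) k (O : set V) n
    (f : 'I_n -> V -> R) : open O -> (forall i, Ck_on k O (f i)) ->
  Ck_on k O (fun z => \sum_i f i z).
Proof.
move=> oO; elim: n f => [|n IH] f Cf.
  apply: Ck_on_ext (Ck_on_cst k O (0 : R)) => // z _; by rewrite big_ord0.
apply: (@Ck_on_ext _ _ _ _ (fun z => \sum_(i < n) f (widen_ord (leqnSn n) i) z
   + f ord_max z)) => //; first by move=> z _; rewrite big_ord_recr.
by apply: Ck_on_add => //; apply: IH => i; exact: Cf.
Qed.

Lemma Ck_on_linear (R : realType) (V : normedModType R) k (O : set V)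
    (f : {linear V -> R}) : continuous f -> Ck_on k O f.
Proof.
move=> cf; case: k => [|k]; split => //; try by move=> z _; exact: cf.
move=> v; have D z : is_derive z v f (f v).
  apply: DeriveDef; first exact/diff_derivable/linear_differentiable.
  by rewrite deriveE ?diff_lin//; exact: linear_differentiable.
split; first by move=> z _; have [] := D z.
rewrite (_ : 'D_v f = fun=> f v); first exact: Ck_on_cst.
by apply/funext => z; have [_ ->] := D z.
Qed.

Lemma derive_scale1 (R : realType) (f : R -> R) (x v : R) :
  derivable f x 1 -> derivable f x v /\ 'D_v f x = v * 'D_1 f x.
Proof.
move=> /derivable1_diffP df; split; first exact: diff_derivable.
rewrite !deriveE//; transitivity ('d f x (v *: (1 : R))).
  by rewrite /GRing.scale/= mulr1.
by rewrite linearZ.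
Qed.

Lemma is_derive1_const (R : realType) (a x : R) : is_derive x 1 (fun=> a) 0.
Proof. exact: is_derive_cst. Qed.

Lemma is_derive1_add (R : realType) (f g : R -> R) (x a b : R) :
  is_derive x 1 f a -> is_derive x 1 g b ->
  is_derive x 1 (fun z => f z + g z) (a + b).
Proof. by move=> Df Dg; exact: is_deriveD. Qed.

Lemma is_derive1_mul (R : realType) (f g : R -> R) (x a b : R) :
  is_derive x 1 f a -> is_derive x 1 g b ->
  is_derive x 1 (fun z => f z * g z) (f x * b + g x * a).
Proof. by move=> Df Dg; exact: is_deriveM. Qed.

(** * Powers of positive parts, and real powers *)

Definition pospow (R : realType) n (y : R) : R := Num.max y 0 ^+ n.

Lemma pospow_ge0 (R : realType) n (y : R) : 0 <= pospow n y.
Proof. by rewrite /pospow exprn_ge0// le_max lexx orbT. Qed.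

Lemma pospow0 (R : realType) n (y : R) : y <= 0 -> pospow n.+1 y = 0.
Proof. by move=> y0; rewrite /pospow max_r// expr0n. Qed.

Lemma pospowE (R : realType) n (y : R) : 0 <= y -> pospow n y = y ^+ n.
Proof. by move=> y0; rewrite /pospow max_l. Qed.

Lemma ler_pospow (R : realType) n : {homo @pospow R n : x y / x <= y}.
Proof.
have m0 (z : R) : 0 <= Num.max z 0 by rewrite le_max lexx orbT.
move=> x y xy; apply: lerXn2r; [exact: m0|exact: m0|].
by rewrite ge_max m0 le_max xy.
Qed.

Lemma continuous_pospow (R : realType) n : continuous (@pospow R n).
Proof.
move=> y; apply: (continuous_comp (f := fun z : R => Num.max z 0)
  (g := fun z : R => z ^+ n)); last exact: exprn_continuous.
by apply: continuous_max; [exact: cvg_id|exact: cvg_cst].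
Qed.

Lemma is_derive_pospow (R : realType) n (y : R) :
  is_derive y 1 (@pospow R n.+2) (n.+2%:R * pospow n.+1 y).
Proof.
have [->|] := eqVneq y 0; last (rewrite neq_lt => /orP[] y0).
(* At 0 the difference quotient of max(z, 0)^(n+2) is max(z, 0)^(n+1). *)
- rewrite [pospow n.+1 0]pospow0// mulr0.
  apply/is_derive1_caratheodory; exists (pospow n.+1); split.
  + move=> z; rewrite [pospow _ 0]pospow0// !subr0.
    have [z0|z0] := leP z 0; first by rewrite !pospow0// mul0r.
    by rewrite !pospowE ?ltW// -exprSr.
  + exact: continuous_pospow.
  + by rewrite pospow0.
- rewrite pospow0 ?mulr0 ?ltW//.
  apply: (@near_eq_is_derive _ _ _ (cst (0 : R))).
  by near=> z; rewrite pospow0// ltW//; near: z; exact: lt_nbhsl.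
- have D : is_derive y 1 (fun z : R => z ^+ n.+2) (n.+2%:R * pospow n.+1 y).
    apply: DeriveDef; first exact: exprn_derivable.
    by rewrite exp_derive /GRing.scale/= mulr1 pospowE// ltW.
  apply: near_eq_is_derive D.
  by near=> z; rewrite pospowE// ltW//; near: z; exact: lt_nbhsr.
Unshelve. all: by end_near. Qed.

Lemma Ck_on_pospow (R : realType) k j :
  Ck_on k [set: R] (@pospow R (k + j).+1).
Proof.
elim: k j => [|k IH] j.
  by split => // z _; exact: continuous_pospow.
split; first by move=> z _; exact: continuous_pospow.
move=> v; rewrite addSn.
have D z : derivable (@pospow R (k + j).+2) z v /\
    'D_v (@pospow R (k + j).+2) z = v * ((k + j).+2%:R * pospow (k + j).+1 z).
  have [d1 d2] := is_derive_pospow (k + j) z.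
  by have [? ->] := derive_scale1 v d1; rewrite d2.
split; first by move=> z _; have [] := D z.
rewrite (_ : 'D_v _ = fun z => v * (k + j).+2%:R * pospow (k + j).+1 z).
  by apply: Ck_on_mul; [exact: openT|exact: Ck_on_cst|exact: IH].
by apply/funext => z; have [_ ->] := D z; rewrite mulrA.
Qed.

Lemma Ck_on_powR (R : realType) k (a : R) :
  Ck_on k [set x : R | 0 < x] (fun x => x `^ a).
Proof.
have oO : open [set x : R | 0 < x] by exact: open_gt.
have cp b (z : R) : 0 < z -> {for z, continuous (fun x => x `^ b)}.
  move=> z0; apply: differentiable_continuous; apply/derivable1_diffP.
  by have [] := is_derive1_powR b z0.
elim: k a => [|k IH] a; first by split => // z; exact: cp.
split => [z|v]; first exact: cp.
have D (z : R) : 0 < z -> derivable (fun x => x `^ a) z v /\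
    'D_v (fun x => x `^ a) z = v * (a * z `^ (a - 1)).
  move=> z0; have [d1 d2] := is_derive1_powR a z0.
  by have [? ->] := derive_scale1 v d1; rewrite d2.
split; first by move=> z /D[].
apply: (@Ck_on_ext _ _ _ _ (fun z => v * a * z `^ (a - 1))) => //.
  by move=> z /D[_ ->]; rewrite mulrA.
by apply: Ck_on_mul => //; exact: Ck_on_cst.
Qed.

Lemma Ck_on_id (R : realType) k (O : set R) : Ck_on k O (fun x => x).
Proof.
case: k => [|k]; split => //; try by move=> z _; exact: cvg_id.
move=> v; split; first by move=> z _; exact: derivable_id.
rewrite (_ : 'D_v _ = fun=> v); first exact: Ck_on_cst.
by apply/funext => z; rewrite derive_id.
Qed.

(** * The decreasing profile *)

Definition hypot (R : realType) (s : R) : R := Num.sqrt (1 + s ^+ 2).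

(** This is 1 / (sqrt (1 + s^2) + s) = exp (- asinh s): it decays like 1 / (2 s)
    at + oo, grows like 2 |s| at - oo, and is smooth and decreasing on the whole
    line. *)
Definition recip (R : realType) (s : R) : R := hypot s - s.

Definition profile (R : realType) (al s : R) : R := recip s `^ al.

Lemma hypot_sqr (R : realType) (s : R) : hypot s ^+ 2 = 1 + s ^+ 2.
Proof. by rewrite /hypot sqr_sqrtr// addr_ge0// sqr_ge0. Qed.

Lemma hypot_ge1 (R : realType) (s : R) : 1 <= hypot s.
Proof. by rewrite -[leLHS]sqrtr1 /hypot ler_wsqrtr// lerDl sqr_ge0. Qed.

Lemma hypot_gt0 (R : realType) (s : R) : 0 < hypot s.
Proof. by rewrite (lt_le_trans _ (hypot_ge1 s)). Qed.

Lemma hypot_gt_norm (R : realType) (s : R) : `|s| < hypot s.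
Proof.
by rewrite -sqrtr_sqr /hypot ltr_sqrt ?ltrDr// (lt_le_trans ltr01)// lerDl sqr_ge0.
Qed.

Lemma recip_gt0 (R : realType) (s : R) : 0 < recip s.
Proof. by rewrite /recip subr_gt0 (le_lt_trans (ler_norm s) (hypot_gt_norm s)). Qed.

Lemma recip_hypot (R : realType) (s : R) : recip s * hypot s = (recip s ^+ 2 + 1) / 2.
Proof. have := hypot_sqr s; rewrite /recip; nra. Qed.

Lemma recipE (R : realType) (s : R) : recip s = (hypot s + s)^-1.
Proof.
have h1 : 0 < hypot s + s.
  by have := hypot_gt_norm s; rewrite ltr_norml => /andP[]; lra.
apply: (mulIf (lt0r_neq0 h1)); rewrite mulVf ?lt0r_neq0//.
by have := hypot_sqr s; rewrite /recip; nra.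
Qed.

Lemma hypot_le (R : realType) (s : R) : 0 <= s -> hypot s <= 1 + s.
Proof. by move=> s0; have := hypot_sqr s; have := hypot_gt0 s; nra. Qed.

Lemma recip_ge (R : realType) (s : R) : 0 <= s -> (1 + 2 * s)^-1 <= recip s.
Proof.
move=> s0; rewrite recipE lef_pV2 ?posrE; first by have := hypot_le s0; lra.
  by lra.
by have := hypot_gt0 s; lra.
Qed.

Lemma recip_le (R : realType) (s : R) : 0 < s -> recip s <= s^-1.
Proof.
move=> s0; rewrite recipE lef_pV2 ?posrE//; have := hypot_gt0 s; lra.
Qed.

Lemma recip_geN (R : realType) (s : R) : - s <= recip s.
Proof. by rewrite /recip; have := hypot_gt0 s; lra. Qed.

Lemma recip_lt2hypot (R : realType) (s : R) : recip s <= 2 * hypot s.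
Proof.
by rewrite /recip; have := hypot_gt_norm s; rewrite ltr_norml => /andP[]; lra.
Qed.

Lemma recip0 (R : realType) : recip (0 : R) = 1.
Proof. by rewrite /recip /hypot expr0n addr0 sqrtr1 subr0. Qed.

Lemma recip_nincr (R : realType) (s t : R) : s <= t -> recip t <= recip s.
Proof.
move=> st; rewrite /recip.
have := hypot_sqr s; have := hypot_sqr t; have := hypot_gt0 s; have := hypot_gt0 t.
have := hypot_gt_norm t; rewrite ltr_norml => /andP[? ?].
have := hypot_gt_norm s; rewrite ltr_norml => /andP[? ?].
nra.
Qed.

Lemma is_derive_hypot (R : realType) (s : R) : is_derive s 1 (@hypot R) (s / hypot s).
Proof.
have h : 0 < 1 + s ^+ 2 by rewrite (lt_le_trans ltr01)// lerDl sqr_ge0.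
have D1 : is_derive s 1 (fun z : R => 1 + z ^+ 2) (2 * s).
  have X : derivable (fun z : R => z ^+ 2) s 1 by exact: exprn_derivable.
  have C := derivable_cst (1 : R) s (1 : R).
  apply: DeriveDef; first exact: derivableD.
  rewrite (deriveD C X) derive_cst exp_derive add0r.
  by rewrite /GRing.scale/= expr1 mulr1.
have := @is_derive1_comp _ Num.sqrt (fun z : R => 1 + z ^+ 2) s _ _
  (is_derive1_sqrt h) D1.
move=> DD; apply: (is_derive_eq DD); rewrite -/(hypot s); have := hypot_gt0 s => h0.
by field; rewrite gt_eqF.
Qed.

Lemma is_derive_recip (R : realType) (s : R) :
  is_derive s 1 (@recip R) (- (recip s / hypot s)).
Proof.
have D := is_derive_hypot s.
have : is_derive s 1 (@hypot R - id) (s / hypot s - 1) by exact: is_deriveB.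
move=> DD; apply: (is_derive_eq DD).
by rewrite /recip; have := hypot_gt0 s => h0; field; rewrite gt_eqF.
Qed.

Lemma profile_gt0 (R : realType) (al s : R) : 0 < profile al s.
Proof. exact/powR_gt0/recip_gt0. Qed.

Lemma profile0 (R : realType) (al : R) : profile al 0 = 1.
Proof. by rewrite /profile recip0 powR1. Qed.

Lemma profile_nincr (R : realType) (al s t : R) : 0 <= al -> s <= t ->
  profile al t <= profile al s.
Proof.
move=> al0 st; apply: ge0_ler_powR => //; last exact: recip_nincr.
  by rewrite nnegrE ltW// recip_gt0.
by rewrite nnegrE ltW// recip_gt0.
Qed.

Lemma is_derive_profile (R : realType) (al s : R) :
  is_derive s 1 (@profile R al) (- (al * profile al s / hypot s)).
Proof.
have := @is_derive1_comp _ (fun x => x `^ al) (@recip R) s _ _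
  (is_derive1_powR al (recip_gt0 s)) (is_derive_recip s).
move=> DD; apply: (is_derive_eq DD); rewrite /profile powRB; last first.
  by apply/implyP => _; rewrite lt0r_neq0// recip_gt0.
rewrite powRr1 ?(ltW (recip_gt0 s))//.
have := hypot_gt0 s => h0; have := recip_gt0 s => r0.
by field; rewrite !gt_eqF.
Qed.

Lemma profile_le1D (R : realType) (al s : R) : 0 <= al -> al <= 1 ->
  profile al s <= 1 + recip s.
Proof.
move=> al0 al1; rewrite /profile; have r0 := recip_gt0 s.
have [r1|r1] := leP (recip s) 1.
  apply: (@le_trans _ _ 1); last by lra.
  rewrite -[leRHS](powRr0 (recip s)).
  apply: ger_powR => //; by rewrite r0.
apply: (@le_trans _ _ (recip s)); last lra.
by apply: ler1_powR => //; exact: ltW.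
Qed.

(** For al <= 1 the profile grows at most linearly at - oo, so that its
    derivative - al * profile / hypot is bounded. *)
Lemma profile_lipschitz (R : realType) (al s t : R) : 0 <= al -> al <= 1 ->
  profile al s - profile al t <= 3 * `|s - t|.
Proof.
move=> al0 al1; have [st|ts] := leP t s.
  apply: (@le_trans _ _ 0); first by rewrite subr_le0 profile_nincr.
  by rewrite mulr_ge0.
have [|c _] := @MVT_segment _ (@profile R al) _ _ _ (ltW ts)
    (fun x _ => is_derive_profile al x).
  apply: continuous_subspaceT => x; apply: differentiable_continuous.
  by apply/derivable1_diffP; have [] := is_derive_profile al x.
move=> E; rewrite -[profile al s - _]opprB E ltr0_norm ?subr_lt0//.
rewrite -mulNr opprK opprB.
rewrite ler_wpM2r ?subr_ge0 ?(ltW ts)//.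
rewrite ler_pdivrMr ?hypot_gt0//.
have := profile_le1D c al0 al1; have := recip_lt2hypot c; have := hypot_ge1 c.
have := profile_gt0 al c; nra.
Qed.

(** Where recip is bounded, the slope of the profile is at least a multiple of
    profile ^ (1 + 1 / al) = profile * recip: this makes the absorption term
    effective far away. *)
Lemma profile_slope_lower (R : realType) (al B s : R) : 0 <= al -> recip s <= B ->
  2 * al / (1 + B ^+ 2) * (profile al s * recip s) <= al * profile al s / hypot s.
Proof.
move=> al0 hB; have h0 := recip_gt0 s; have k0 := profile_gt0 al s.
have v0 := hypot_gt0 s; have rh := recip_hypot s.
have B0 : 0 < B := lt_le_trans h0 hB.
rewrite ler_pdivlMr// [leLHS](_ : _ = al * profile al s *
  ((2 * (recip s * hypot s)) / (1 + B ^+ 2))); last first.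
  by field; rewrite lt0r_neq0// ltr_pwDl// exprn_ge0// ltW.
rewrite -[leRHS]mulr1; apply: ler_wpM2l; first by rewrite mulr_ge0// ltW.
rewrite ler_pdivrMr; last by rewrite ltr_pwDl// exprn_ge0// ltW.
have : recip s ^+ 2 <= B ^+ 2.
  by apply: lerXn2r; rewrite ?nnegrE ?(ltW h0) ?(ltW B0).
by rewrite rh mul1r; lra.
Qed.

Lemma profile_small (R : realType) (al eta : R) : 0 < al -> 0 < eta ->
  exists2 S, 0 < S & forall s, S <= s -> profile al s <= eta.
Proof.
move=> al0 eta0; exists (eta `^ (- al^-1)); first exact: powR_gt0.
move=> s Ss; have S0 : 0 < eta `^ (- al^-1) by exact: powR_gt0.
have s0 := lt_le_trans S0 Ss; rewrite /profile.
have -> : eta = (eta `^ al^-1) `^ al.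
  by rewrite -powRrM mulVf ?lt0r_neq0// powRr1// ltW.
apply: ge0_ler_powR; rewrite ?nnegrE ?powR_ge0 ?(ltW al0)//.
  exact/ltW/recip_gt0.
apply: le_trans (recip_le s0) _.
by rewrite -[leRHS]invrK -powRN lef_pV2 ?posrE.
Qed.

Lemma Ck_on_profile (R : realType) k (al : R) : Ck_on k [set: R] (@profile R al).
Proof.
have Ch : Ck_on k [set: R] (@hypot R).
  apply: (@Ck_on_ext _ _ _ _ (fun s : R => (1 + s * s) `^ 2^-1)); first exact: openT.
    move=> s _; rewrite powR12_sqrt /hypot ?expr2//.
    by rewrite -expr2 addr_ge0// sqr_ge0.
  apply: (@Ck_on_comp _ _ _ _ [set x : R | 0 < x] (fun x => x `^ 2^-1)).
  - exact: openT.
  - by move=> s _ /=; rewrite (lt_le_trans ltr01)// lerDl -expr2 sqr_ge0.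
  - exact: Ck_on_powR.
  - apply: Ck_on_add; [exact: openT|exact: Ck_on_cst|].
    by apply: Ck_on_mul; [exact: openT|exact: Ck_on_id|exact: Ck_on_id].
apply: (@Ck_on_comp _ _ _ _ [set x : R | 0 < x] (fun x => x `^ al) (@recip R)).
- exact: openT.
- by move=> s _; exact: recip_gt0.
- exact: Ck_on_powR.
- apply: (@Ck_on_ext _ _ _ _ (fun s : R => hypot s + (-1) * s)); first exact: openT.
    by move=> s _; rewrite mulN1r.
  apply: Ck_on_add => //; first exact: openT.
  by apply: Ck_on_mul; [exact: openT|exact: Ck_on_cst|exact: Ck_on_id].
Qed.

(** * Euclidean norm and paraboloids *)

Lemma enorm_ge0 (R : realType) N (x : 'rV[R]_N) : 0 <= enorm x.
Proof. exact: sqrtr_ge0. Qed.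

Lemma enorm_sqr (R : realType) N (x : 'rV[R]_N) :
  enorm x ^+ 2 = \sum_i x 0 i ^+ 2.
Proof. by rewrite sqr_sqrtr// sumr_ge0// => i _; exact: sqr_ge0. Qed.

Lemma enormZ (R : realType) N (a : R) (x : 'rV[R]_N) :
  enorm (a *: x) = `|a| * enorm x.
Proof.
rewrite /enorm -sqrtr_sqr -sqrtrM ?sqr_ge0// mulr_sumr; congr (Num.sqrt _).
by apply: eq_bigr => i _; rewrite mxE exprMn.
Qed.

(** The Cauchy-Schwarz inequality, from the nonnegativity of
    |s x - t y|^2 for s = |y| and t = |x|; the cases where one of the norms
    vanishes need another choice of s and t. *)
Lemma enorm_dot (R : realType) N (x y : 'rV[R]_N) :
  \sum_i x 0 i * y 0 i <= enorm x * enorm y.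
Proof.
set a := enorm x; set b := enorm y; set d := \sum_i _.
have a0 : 0 <= a by exact: enorm_ge0.
have b0 : 0 <= b by exact: enorm_ge0.
have H (s t : R) : 0 <= s ^+ 2 * a ^+ 2 - 2 * s * t * d + t ^+ 2 * b ^+ 2.
  rewrite !enorm_sqr /d !mulr_sumr -sumrB -big_split/=.
  by apply: sumr_ge0 => i _; rewrite -[leRHS]/(_ + _) (_ : _ + _ = (s * x 0 i - t * y 0 i) ^+ 2) ?sqr_ge0//; ring.
have [a1|a1] := eqVneq a 0; have [b1|b1] := eqVneq b 0.
- by have := H 1 1; rewrite a1 b1; lra.
- have h := H (b ^+ 2) d; rewrite a1 mul0r leNgt; apply/negP => d0.
  have b2 : 0 < b ^+ 2 by rewrite exprn_even_gt0.
  by have := mulr_gt0 b2 (exprn_gt0 2 d0); move: h; rewrite a1; lra.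
- have h := H d (a ^+ 2); rewrite b1 mulr0 leNgt; apply/negP => d0.
  have a2 : 0 < a ^+ 2 by rewrite exprn_even_gt0.
  by have := mulr_gt0 a2 (exprn_gt0 2 d0); move: h; rewrite b1; lra.
- have aP : 0 < a by rewrite lt0r a1.
  have bP : 0 < b by rewrite lt0r b1.
  have ab : 0 < a * b by rewrite mulr_gt0.
  by have := H b a; nra.
Qed.

Lemma enorm_coord (R : realType) N (x : 'rV[R]_N) i : `|x 0 i| <= enorm x.
Proof.
rewrite -sqrtr_sqr /enorm ler_wsqrtr// (bigD1 i)//= lerDl sumr_ge0// => k _.
exact: sqr_ge0.
Qed.

Lemma norm_le_enorm (R : realType) N (x : 'rV[R]_N) : `|x| <= enorm x.
Proof.
rewrite [leLHS]/Num.norm/= mx_normrE; apply/bigmax_leP; split => [|[i k] _].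
  exact: enorm_ge0.
by rewrite (ord1 i)/=; exact: enorm_coord.
Qed.

(** For small ep this is the linear form e . x, bent down so as to tend to - oo
    at infinity. It is, up to a factor and a constant, minus the squared distance
    to its only critical point e / ep. *)
Definition paraboloid (R : realType) N (e : 'rV[R]_N) (ep : R) (x : 'rV[R]_N) : R :=
  \sum_i (e 0 i * x 0 i - ep / 2 * x 0 i ^+ 2).

Lemma paraboloid_le (R : realType) N (e : 'rV[R]_N) (ep : R) (x : 'rV[R]_N) :
  paraboloid e ep x <= enorm e * enorm x - ep / 2 * enorm x ^+ 2.
Proof. by rewrite enorm_sqr /paraboloid sumrB -mulr_sumr lerD2r enorm_dot. Qed.

(** The length of the gradient e - ep x is a function of the value of the
    paraboloid: thus a function of the paraboloid has an explicit p-Laplacian in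
    one variable. *)
Lemma enorm_grad_paraboloid (R : realType) N (e : 'rV[R]_N) (ep : R) x :
  enorm (e - ep *: x) = Num.sqrt (enorm e ^+ 2 - 2 * ep * paraboloid e ep x).
Proof.
rewrite enorm_sqr /paraboloid mulr_sumr -sumrB /enorm; congr (Num.sqrt _).
by apply: eq_bigr => i _; rewrite !mxE; field.
Qed.

Lemma enorm_grad_paraboloid2 (R : realType) N (e : 'rV[R]_N) (ep : R) x :
  enorm (e - ep *: x) ^+ 2 = enorm e ^+ 2 - 2 * ep * paraboloid e ep x.
Proof.
rewrite !enorm_sqr /paraboloid mulr_sumr -sumrB.
by apply: eq_bigr => i _; rewrite !mxE; field.
Qed.

Lemma paraboloid_lipschitz (R : realType) N (e : 'rV[R]_N) (ep : R) x y :
  0 <= ep -> enorm (y - x) <= 1 ->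
  `|paraboloid e ep y - paraboloid e ep x| <=
     (enorm (e - ep *: x) + ep) * enorm (y - x).
Proof.
move=> ep0 d1; set g := e - ep *: x; set d := y - x.
have E : paraboloid e ep y - paraboloid e ep x =
    (\sum_i g 0 i * d 0 i) - ep / 2 * enorm d ^+ 2.
  rewrite enorm_sqr mulr_sumr -!sumrB; apply: eq_bigr => i _.
  by rewrite !mxE; field.
have H1 := enorm_dot g d.
have H2 : - (\sum_i g 0 i * d 0 i) <= enorm g * enorm d.
  have := enorm_dot (-1 *: g) d; rewrite enormZ normrN1 mul1r -sumrN.
  by under eq_bigr do rewrite mxE mulN1r mulNr.
have d0 := enorm_ge0 d; have g0 := enorm_ge0 g.
have K1 : 0 <= ep * (enorm d * (1 - enorm d)) by rewrite !mulr_ge0// subr_ge0.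
have K2 : 0 <= ep * enorm d ^+ 2 by rewrite mulr_ge0// exprn_ge0.
have K3 : 0 <= ep * enorm d by rewrite mulr_ge0.
by rewrite E ler_norml; apply/andP; split; lra.
Qed.

Lemma is_derive_paraboloid (R : realType) N (e : 'rV[R]_N) (ep : R) x i :
  is_derive x (basis_vec R i) (paraboloid e ep) (e 0 i - ep * x 0 i).
Proof.
apply: is_derive_dir.
have E : (fun h : R => paraboloid e ep (h *: basis_vec R i + x)) =
    (fun h => paraboloid e ep x + ((e 0 i - ep * x 0 i) * h - ep / 2 * h ^+ 2)).
  apply/funext => h; rewrite /paraboloid (bigD1 i)//= [in RHS](bigD1 i)//=.
  rewrite !mxE !eqxx/= mulr1.
  under eq_bigr => k ki do rewrite !mxE (negbTE ki) andbF mulr0 add0r.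
  by field.
rewrite E.
set p : {poly R} := (paraboloid e ep x)%:P + ((e 0 i - ep * x 0 i) *: 'X - (ep / 2) *: 'X^2).
have F : (fun h => paraboloid e ep x + ((e 0 i - ep * x 0 i) * h - ep / 2 * h ^+ 2)) =
    (fun h : R => p.[h]) by apply/funext => h; rewrite /p !hornerE.
rewrite F; have D := is_derive_poly p (0 : R).
apply: (is_derive_eq D).
by rewrite horner_coef0 coef_deriv /p !coefE/= !(mulr1, mulr0, subr0, add0r).
Qed.

Lemma is_derive_coord (R : realType) N (x : 'rV[R]_N) i :
  is_derive x (basis_vec R i) (fun y : 'rV[R]_N => y 0 i) 1.
Proof.
apply: is_derive_dir; rewrite (_ : (fun h => _) = (id + cst (x 0 i))).
  apply: is_derive_eq; exact: addr0.
by apply/funext => h; rewrite !mxE !eqxx mulr1.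
Qed.

Lemma Ck_on_time (R : realType) N k (O : set (R * 'rV[R]_N)) :
  Ck_on k O (fun z => z.1).
Proof.
pose f (z : R * 'rV[R]_N) := z.1.
have lf : linear f by [].
pose HL := GRing.isLinear.Build _ _ _ _ f lf.
pose F : {linear (R * 'rV[R]_N)%type -> R} := HB.pack f HL.
by apply: (@Ck_on_linear _ _ _ _ F) => z; exact: cvg_fst.
Qed.

Lemma Ck_on_space_coord (R : realType) N k (O : set (R * 'rV[R]_N)) i :
  Ck_on k O (fun z => z.2 0 i).
Proof.
pose f (z : R * 'rV[R]_N) := z.2 0 i.
have lf : linear f by move=> a u v; rewrite /f !mxE.
pose HL := GRing.isLinear.Build _ _ _ _ f lf.
pose F : {linear (R * 'rV[R]_N)%type -> R} := HB.pack f HL.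
apply: (@Ck_on_linear _ _ _ _ F) => z.
apply: (continuous_comp (f := snd) (g := fun x : 'rV[R]_N => x 0 i)).
  exact: cvg_snd.
exact: coord_continuous.
Qed.

Lemma Ck_on_paraboloid (R : realType) N (e : 'rV[R]_N) ep k
    (O : set (R * 'rV[R]_N)) : open O ->
  Ck_on k O (fun z => paraboloid e ep z.2).
Proof.
move=> oO; apply: Ck_on_sum => // i.
apply: (@Ck_on_ext _ _ _ _ (fun z : R * 'rV[R]_N => e 0 i * z.2 0 i +
  (- (ep / 2)) * (z.2 0 i * z.2 0 i))) => //.
  by move=> z _; rewrite mulNr expr2.
apply: Ck_on_add => //; apply: Ck_on_mul => //; try exact: Ck_on_cst.
  exact: Ck_on_space_coord.
by apply: Ck_on_mul => //; exact: Ck_on_space_coord.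
Qed.

(** * The barrier *)

(** This is 2 c t / (1 + c t). A bounded clock is needed because the slope of the
    profile may degenerate at - oo: the positivity of profile - clock together
    with an upper bound on the difference then confines the profile to a bounded
    range. It reaches 1 = profile al 0 at time 1 / c. *)
Definition clock (R : realType) (c t : R) : R := 2 - 2 / (1 + c * t).

Lemma clock_ge0 (R : realType) (c t : R) : 0 <= c -> 0 <= t -> 0 <= clock c t.
Proof.
move=> c0 t0; rewrite /clock subr_ge0 ler_pdivrMr; last first.
  by rewrite ltr_pwDl// mulr_ge0.
by rewrite ler_pMr// lerDl mulr_ge0.
Qed.

Lemma clock_gt0 (R : realType) (c t : R) : 0 < c -> 0 < t -> 0 < clock c t.
Proof.
move=> c0 t0; have ct : 0 < c * t by rewrite mulr_gt0.
rewrite /clock subr_gt0 ltr_pdivrMr; last by rewrite ltr_wpDr// ltW.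
by rewrite ltr_pMr// ltrDl.
Qed.

Lemma clock_ndecr (R : realType) (c s t : R) : 0 <= c -> 0 <= s -> s <= t ->
  clock c s <= clock c t.
Proof.
move=> c0 s0 st; have cs := mulr_ge0 c0 s0; have cst := ler_wpM2l c0 st.
rewrite /clock lerD2l lerN2; apply: ler_wpM2l => //.
by rewrite lef_pV2 ?posrE; lra.
Qed.

Lemma clock_lipschitz (R : realType) (c t t0 : R) : 0 <= c -> 0 <= t -> 0 <= t0 ->
  clock c t0 - clock c t <= 2 * c * `|t - t0|.
Proof.
move=> c0 t1 t2; rewrite /clock.
have u1 : 1 <= 1 + c * t by rewrite lerDl mulr_ge0.
have u2 : 1 <= 1 + c * t0 by rewrite lerDl mulr_ge0.
have uP : 0 < (1 + c * t) * (1 + c * t0) by rewrite mulr_gt0//; lra.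
rewrite (_ : _ - _ = 2 * c * (t0 - t) / ((1 + c * t) * (1 + c * t0))); last first.
  by field; apply/andP; split; rewrite lt0r_neq0//; lra.
rewrite ler_pdivrMr//; apply: (@le_trans _ _ (2 * c * `|t - t0| * 1)); last first.
  by rewrite ler_wpM2l ?mulr_ge0//; nra.
by rewrite mulr1 ler_wpM2l ?mulr_ge0// distrC ler_norm.
Qed.

Section Barrier.
Context (R : realType) (N : nat) (e : 'rV[R]_N) (ep al k1 c M kap lam : R).
Context (j : nat).

Definition slack (t s : R) : R := profile al s - k1 - clock c t.

Definition planar (t s : R) : R :=
  M * pospow j.+3 (slack t s) + (kap + lam * t).

(** Minus the derivative of [planar] in s. *)
Definition slope (t s : R) : R :=
  M * j.+3%:R * pospow j.+2 (slack t s) * (al * profile al s / hypot s).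

Definition barrier (t : R) (x : 'rV[R]_N) : R := planar t (paraboloid e ep x).

Local Notation sg := (paraboloid e ep).

Lemma is_derive_slack (t s : R) :
  is_derive s 1 (slack t) (- (al * profile al s / hypot s)).
Proof.
have D := is_derive1_add (is_derive1_add (is_derive_profile al s)
  (is_derive1_const (- k1) s)) (is_derive1_const (- clock c t) s).
by rewrite !addr0 in D.
Qed.

Lemma is_derive_planar (t s : R) : is_derive s 1 (planar t) (- slope t s).
Proof.
have D := @is_derive1_comp _ (@pospow R j.+3) (slack t) s _ _
  (is_derive_pospow _ _) (is_derive_slack t s).
have D2 := is_derive1_add (is_derive1_mul (is_derive1_const M s) D)
  (is_derive1_const (kap + lam * t) s).
apply: (is_derive_eq D2); rewrite /slope; ring.
Qed.

Lemma is_derive_barrier (x : 'rV[R]_N) (t : R) i :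
  is_derive x (basis_vec R i) (barrier t)
    (- slope t (sg x) * (e 0 i - ep * x 0 i)).
Proof.
exact: (@is_derive_comp_dir _ _ (planar t) sg _ _ _ _
  (is_derive_paraboloid e ep x i) (is_derive_planar t (sg x))).
Qed.

Lemma grad_barrier (t : R) (x : 'rV[R]_N) :
  grad (barrier t) x = - slope t (sg x) *: (e - ep *: x).
Proof.
by apply/rowP => i; rewrite !mxE; have [_ ->] := is_derive_barrier x t i.
Qed.

Lemma is_derive_barrier_time (t : R) (x : 'rV[R]_N) : 0 < 1 + c * t ->
  is_derive t 1 (barrier^~ x)
    (lam - M * j.+3%:R * pospow j.+2 (slack t (sg x)) *
       (2 * c / (1 + c * t) ^+ 2)).
Proof.
move=> ct0.
have DI : is_derive t 1 (fun z : R => (1 + c * z)^-1) (- (c / (1 + c * t) ^+ 2)).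
  have D0 := is_derive1_add (is_derive1_const 1 t)
    (is_derive1_mul (is_derive1_const c t) (is_derive_id t (1 : R))).
  have DD := @is_deriveV _ (fun z : R => 1 + c * z) _ _ _ (lt0r_neq0 ct0) D0.
  apply: (is_derive_eq DD).
  rewrite /GRing.scale/=; field; exact: lt0r_neq0.
have DS : is_derive t 1 (fun z => slack z (sg x)) (- (2 * c / (1 + c * t) ^+ 2)).
  have D1 := is_derive1_add (is_derive1_const (profile al (sg x) - k1 - 2) t)
    (is_derive1_mul (is_derive1_const 2 t) DI).
  rewrite (_ : (fun z => slack z _) = (fun z => profile al (sg x) - k1 - 2 +
     2 * (1 + c * z)^-1)).
    apply: (is_derive_eq D1); field; exact: lt0r_neq0.
  by apply/funext => z; rewrite /slack /clock; ring.
have D := @is_derive1_comp _ (@pospow R j.+3) _ t _ _ (is_derive_pospow _ _) DS.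
have D2 := is_derive1_add (is_derive1_mul (is_derive1_const M t) D)
  (is_derive1_add (is_derive1_const kap t)
     (is_derive1_mul (is_derive1_const lam t) (is_derive_id t (1 : R)))).
apply: (is_derive_eq D2); field; exact: lt0r_neq0.
Qed.

Definition dslope (t s : R) : R :=
  - (M * j.+3%:R * (al * profile al s / hypot s) *
    (j.+2%:R * pospow j.+1 (slack t s) * (al * profile al s / hypot s) +
     pospow j.+2 (slack t s) * (al / hypot s + s / hypot s ^+ 2))).

Lemma is_derive_slope (t s : R) : is_derive s 1 (slope t) (dslope t s).
Proof.
have h0 := lt0r_neq0 (hypot_gt0 s).
have D := @is_derive1_comp _ (@pospow R j.+2) (slack t) s _ _
  (is_derive_pospow _ _) (is_derive_slack t s).
have DH := @is_deriveV _ _ _ _ _ h0 (is_derive_hypot s).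
have DK := is_derive1_mul (is_derive1_mul (is_derive1_const al s)
  (is_derive_profile al s)) DH.
have D2 := is_derive1_mul (is_derive1_mul (is_derive1_const (M * j.+3%:R) s) D) DK.
apply: (is_derive_eq D2); rewrite /dslope /GRing.scale/=; field; exact: h0.
Qed.

(** The domain is larger than the open half-space t > 0, so that continuity up to
    t = 0 comes with it. *)
Lemma Ck_on_barrier :
  Ck_on 2 [set z : R * 'rV[R]_N | 0 < 1 + c * z.1] (uncurried barrier).
Proof.
set Q := [set z | _].
have oQ : open Q.
  apply: (@open_comp _ _ (fun z : R * 'rV[R]_N => 1 + c * z.1)
    [set t : R | 0 < t]); last exact: open_gt.
  move=> z _; apply: cvgD; first exact: cvg_cst.
  by apply: cvgM; [exact: cvg_cst|exact: cvg_fst].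
have CT : Ck_on 2 Q (fun z => z.1) by exact: Ck_on_time.
have Cc a : Ck_on 2 Q (fun=> a) by exact: Ck_on_cst.
have Cp : Ck_on 2 Q (fun z => sg z.2) := Ck_on_paraboloid e ep 2 oQ.
have Csp : Ck_on 2 Q (fun z => profile al (sg z.2)).
  exact: (@Ck_on_comp R _ 2 Q [set: R] (profile al) (fun z => sg z.2) oQ
    (fun _ _ => I) (Ck_on_profile 2 al) Cp).
have Ct1 : Ck_on 2 Q (fun z => 1 + c * z.1).
  exact: (Ck_on_add oQ (Cc 1) (Ck_on_mul oQ (Cc c) CT)).
have Ccl : Ck_on 2 Q (fun z => (1 + c * z.1) `^ (-1)).
  exact: (@Ck_on_comp R _ 2 Q _ (fun x => x `^ (-1)) (fun z => 1 + c * z.1) oQ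
    (fun _ h => h) (Ck_on_powR 2 (-1)) Ct1).
have Csl : Ck_on 2 Q (fun z => slack z.1 (sg z.2)).
  have Cs := Ck_on_add oQ Csp (Ck_on_add oQ (Cc (- (k1 + 2)))
    (Ck_on_mul oQ (Cc 2) Ccl)).
  apply: Ck_on_ext oQ _ Cs => z z0; rewrite powR_inv1 /slack /clock; first ring.
  exact: ltW z0.
have Cw : Ck_on 2 Q (fun z => pospow j.+3 (slack z.1 (sg z.2))).
  exact: (@Ck_on_comp R _ 2 Q [set: R] (pospow j.+3)
    (fun z => slack z.1 (sg z.2)) oQ (fun _ _ => I) (Ck_on_pospow _ 2 j) Csl).
exact: (Ck_on_add oQ (Ck_on_mul oQ (Cc M) Cw)
  (Ck_on_add oQ (Cc kap) (Ck_on_mul oQ (Cc lam) CT))).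
Qed.

End Barrier.

(** * The p-Laplacian of the barrier *)

Section BarrierLaplacian.
Context (R : realType) (N : nat) (e : 'rV[R]_N) (ep al k1 c M kap lam : R).
Context (j : nat) (p : R).
Context (M_gt0 : 0 < M) (al_gt0 : 0 < al) (ep_ge0 : 0 <= ep).
Context (p_gt1 : 1 < p) (p_le2 : p <= 2).

Local Notation sg := (paraboloid e ep).
Local Notation slackB := (slack al k1 c).
Local Notation slopeB := (slope al k1 c M j).
Local Notation dslopeB := (dslope al k1 c M j).
Local Notation barrierB := (barrier e ep al k1 c M kap lam j).

Lemma slope_ge0 t s : 0 <= slopeB t s.
Proof.
have k0 := profile_gt0 al s; have h0 := hypot_gt0 s.
apply: mulr_ge0; last by rewrite ltW// divr_gt0// mulr_gt0.
by apply: mulr_ge0; [rewrite mulr_ge0// ltW|exact: pospow_ge0].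
Qed.

Lemma slope_gt0 t s : 0 < slackB t s -> 0 < slopeB t s.
Proof.
move=> Y0; have k0 := profile_gt0 al s; have h0 := hypot_gt0 s.
apply: mulr_gt0; last by rewrite divr_gt0// mulr_gt0.
apply: mulr_gt0; first by rewrite mulr_gt0// ltr0n.
by rewrite pospowE ?(ltW Y0)// exprn_gt0.
Qed.

(** The vector field |grad psi|^(p-2) grad psi of the barrier psi is
    - flux times the gradient of the paraboloid. *)
Definition flux (t s : R) : R :=
  slopeB t s `^ (p - 1) * (enorm e ^+ 2 - 2 * ep * s) `^ ((p - 2) / 2).

Lemma flux_barrier (t : R) (y : 'rV[R]_N) i :
  (enorm (grad (barrierB t) y) `^ (p - 2) *: grad (barrierB t) y) 0 i =
  - flux t (sg y) * (e 0 i - ep * y 0 i).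
Proof.
rewrite grad_barrier enormZ normrN (ger0_norm (slope_ge0 _ _)) !mxE mulrA.
congr (_ * _); rewrite powRM ?slope_ge0 ?enorm_ge0// mulrN; congr (- _).
have G0 : 0 <= enorm e ^+ 2 - 2 * ep * sg y.
  by rewrite -enorm_grad_paraboloid2 sqr_ge0.
rewrite /flux -(@mulr_powRB1 _ (slopeB t (sg y)) (p - 1)) ?slope_ge0 ?subr_gt0//.
rewrite (_ : p - 1 - 1 = p - 2); last by ring.
by rewrite enorm_grad_paraboloid -powR12_sqrt// -powRrM [2^-1 * _]mulrC; ring.
Qed.

Lemma plap_barrier (t : R) (x : 'rV[R]_N) (dQ : R) :
  is_derive (sg x) 1 (flux t) dQ ->
  plap p (barrierB t) x =
    - dQ * enorm (e - ep *: x) ^+ 2 + ep * N%:R * flux t (sg x).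
Proof.
move=> DQ; rewrite /plap /divergence.
have D i : 'D_(basis_vec R i) (fun y : 'rV[R]_N =>
     (enorm (grad (barrierB t) y) `^ (p - 2) *: grad (barrierB t) y) 0 i) x =
   - dQ * (e 0 i - ep * x 0 i) ^+ 2 + ep * flux t (sg x).
  rewrite (_ : (fun y => _) = (fun y => (flux t \o sg) y *
      (ep * y 0 i + - e 0 i))); last first.
    by apply/funext => y; rewrite flux_barrier /=; ring.
  have D1 := is_derive_comp_dir (is_derive_paraboloid e ep x i) DQ.
  have D2 : is_derive x (basis_vec R i)
      (fun y : 'rV[R]_N => ep * y 0 i + - e 0 i) ep.
    apply: (is_derive_eq (is_deriveD (is_deriveM (is_derive_cst ep x _)
      (is_derive_coord x i)) (is_derive_cst (- e 0 i) x _))).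
    by rewrite /GRing.scale/= /cst/= mulr0 !addr0 mulr1.
  have [_ ->] := is_deriveM D1 D2.
  by rewrite /GRing.scale/=; ring.
rewrite (eq_bigr _ (fun i _ => D i)) big_split/= -mulr_sumr enorm_sqr.
congr (_ * _ + _).
  by apply: eq_bigr => i _; rewrite !mxE.
by rewrite sumr_const card_ord -mulr_natr; ring.
Qed.

(** Written as a multiple of [flux]: it is the logarithmic derivative that has
    simple terms. *)
Lemma is_derive_flux (t s : R) :
  0 < slackB t s -> 0 < enorm e ^+ 2 - 2 * ep * s ->
  is_derive s 1 (flux t) (flux t s * (- (p - 1) *
     (j.+2%:R * (al * profile al s / hypot s) / slackB t s + al / hypot s +
      s / hypot s ^+ 2) + (2 - p) * ep / (enorm e ^+ 2 - 2 * ep * s))).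
Proof.
move=> Y0 G0; set G := enorm e ^+ 2 - 2 * ep * s.
have S0 := slope_gt0 Y0.
have DG : is_derive s 1 (fun z : R => enorm e ^+ 2 + (- (2 * ep)) * z) (- (2 * ep)).
  apply: (is_derive_eq (is_derive1_add (is_derive1_const _ s)
    (is_derive1_mul (is_derive1_const _ s) (is_derive_id s (1 : R))))).
  by rewrite mulr1 mulr0 addr0 add0r.
have GE z : enorm e ^+ 2 + (- (2 * ep)) * z = enorm e ^+ 2 - 2 * ep * z by ring.
have G0' : 0 < enorm e ^+ 2 + (- (2 * ep)) * s by rewrite GE.
have D1 := @is_derive1_comp _ (fun x => x `^ (p - 1)) (slopeB t) s _ _
  (is_derive1_powR (p - 1) S0) (is_derive_slope al k1 c M j t s).
have D2 := @is_derive1_comp _ (fun x => x `^ ((p - 2) / 2))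
  (fun z : R => enorm e ^+ 2 + (- (2 * ep)) * z) s _ _
  (is_derive1_powR ((p - 2) / 2) G0') DG.
have D := is_derive1_mul D1 D2.
rewrite (_ : flux t = (fun z => (((fun x : R => x `^ (p - 1)) \o slopeB t) z *
  ((fun x : R => x `^ ((p - 2) / 2)) \o
   (fun z : R => enorm e ^+ 2 + - (2 * ep) * z)) z))); last first.
  by apply/funext => z; rewrite /flux /= GE.
apply: (is_derive_eq D) => /=; rewrite !GE -/G.
rewrite [slopeB t s `^ (p - 1 - 1)]powRB ?lt0r_neq0 ?implybT//.
rewrite [G `^ (_ - 1)]powRB ?lt0r_neq0 ?implybT//.
rewrite !powRr1 ?(ltW S0) ?(ltW G0)//.
have h0 := lt0r_neq0 (hypot_gt0 s); have Y1 := lt0r_neq0 Y0.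
have G1 := lt0r_neq0 G0; have S1 := lt0r_neq0 S0.
have -> : dslopeB t s = - slopeB t s * (j.+2%:R * (al * profile al s / hypot s) /
   slackB t s + al / hypot s + s / hypot s ^+ 2).
  rewrite /dslope /slope !pospowE ?(ltW Y0)// [_ ^+ j.+2]exprS.
  by field; rewrite h0 Y1.
set A := slopeB t s `^ _; set B := G `^ _; set S := slopeB t s in S1 *.
by field; rewrite h0 Y1 S1 -/G G1.
Qed.

(** The factor |grad|^(p-2) of the paraboloid contributes a nonpositive term, since
    p <= 2, which is dropped. The first term in the bracket comes from
    the edge of the support, the next two from the curvature of the profile, and
    the last one from the curvature of the paraboloid. *)
Lemma plap_barrier_le (t : R) (x : 'rV[R]_N) : let s := sg x in
  0 < slackB t s -> 0 < enorm (e - ep *: x) ^+ 2 ->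
  plap p (barrierB t) x <= flux t s * ((p - 1) * enorm (e - ep *: x) ^+ 2 *
    (j.+2%:R * (al * profile al s / hypot s) / slackB t s + al / hypot s +
      s / hypot s ^+ 2) + ep * N%:R).
Proof.
move=> s Y0 G0; have GE := enorm_grad_paraboloid2 e ep x.
have G0' : 0 < enorm e ^+ 2 - 2 * ep * s by rewrite -GE.
rewrite (plap_barrier (is_derive_flux Y0 G0')) -/s GE -/s.
set G := _ - _ in G0' *.
have F0 : 0 <= flux t s by rewrite mulr_ge0// powR_ge0.
set Z := _ / slackB t s + _ + _.
have : 0 <= flux t s * ((2 - p) * ep) by apply: mulr_ge0 => //; apply: mulr_ge0 => //; rewrite subr_ge0.
have -> : - (flux t s * (- (p - 1) * Z + (2 - p) * ep / G)) * G =
  flux t s * ((p - 1) * G * Z) - flux t s * ((2 - p) * ep).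
  by field; exact: lt0r_neq0.
lra.
Qed.

(** When p = 2 there is no convention at critical points, and the Laplacian has to
    be computed where the barrier is constant in x, including at the edge of its
    support. *)
Lemma plap2_barrier0 (t : R) (x : 'rV[R]_N) : p = 2 ->
  slackB t (sg x) <= 0 -> plap p (barrierB t) x = 0.
Proof.
move=> p2 Y0.
have FE : flux t = slopeB t.
  apply/funext => z; rewrite /flux p2 subrr mul0r powRr0 mulr1.
  by rewrite (_ : 2 - 1 = 1) ?powRr1 ?slope_ge0//; ring.
have D : is_derive (sg x) 1 (flux t) (dslopeB t (sg x)).
  by rewrite FE; exact: is_derive_slope.
by rewrite (plap_barrier D) FE /dslope /slope !(pospow0 _ Y0) !(mul0r,mulr0,addr0,oppr0).
Qed.

End BarrierLaplacian.

(** * Admissibility of the barrier *)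

Lemma derive1_monomial (R : realType) (A : R) n :
  derive1 (fun r : R => A * r ^+ n.+1) = (fun r => A * n.+1%:R * r ^+ n).
Proof.
apply/funext => r; rewrite derive1E.
have D : is_derive r 1 (fun z : R => z ^+ n.+1) (n.+1%:R * r ^+ n).
  apply: DeriveDef; first exact: exprn_derivable.
  by rewrite exp_derive /GRing.scale/= mulr1.
have [_ ->] := is_derive1_mul (is_derive1_const A r) D.
by rewrite mulr0 addr0 mulrA.
Qed.

Lemma Ck_on_monomial (R : realType) k (O : set R) (A : R) n : open O ->
  Ck_on k O (fun r : R => A * r ^+ n).
Proof.
move=> oO; apply: Ck_on_mul => //; first exact: Ck_on_cst.
elim: n => [|n IH].
  by apply: Ck_on_ext (Ck_on_cst k O (1 : R)) => // z _; rewrite expr0.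
apply: (@Ck_on_ext _ _ _ _ (fun z : R => z * z ^+ n)) => //.
  by move=> z _; rewrite exprS.
by apply: Ck_on_mul => //; exact: Ck_on_id.
Qed.

(** The weighted second derivative of r^n is a multiple of
    r^((n-1)(p-1) - 1). *)
Lemma flat_class_monomial (R : realType) (p A : R) j : 0 < A ->
  1 < j.+2%:R * (p - 1) -> flat_class p (fun r => A * r ^+ j.+3).
Proof.
move=> A0 jp; split.
- exact: Ck_on_monomial openT.
- by split; rewrite /derive1n/= ?derive1_monomial ?expr0n/= mulr0.
- move=> r r0; rewrite /derive1n/= !derive1_monomial.
  by rewrite !mulr_gt0// ?ltr0n// exprn_gt0.
- rewrite /derive1n/= !derive1_monomial.
  set B := A * j.+3%:R; have B0 : 0 < B by rewrite mulr_gt0// ltr0n.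
  pose g (r : R) := B `^ (p - 2) * (B * j.+2%:R) * r `^ (j.+2%:R * (p - 1) - 1).
  apply: (@cvg_trans _ (g r @[r --> 0^'+])).
    apply: near_eq_cvg; near=> r.
    have r0 : 0 < r by near: r; exact: nbhs_right_gt.
    have rn : 0 <= r ^+ j.+2 by rewrite exprn_ge0// ltW.
    rewrite /g ger0_norm; last by rewrite mulr_ge0// ltW.
    rewrite powRM ?(ltW B0)//.
    rewrite -!powR_mulrn ?(ltW r0)// -powRrM.
    rewrite (_ : j.+2%:R * (p - 1) - 1 = j.+2%:R * (p - 2) + j.+1%:R); last first.
      by rewrite (_ : j.+2%:R = j.+1%:R + 1 :> R) ?natr1//; ring.
    rewrite (@powRD _ r (j.+2%:R * (p - 2)) j.+1%:R); last by apply/implyP => _; exact: lt0r_neq0.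
    by ring.
  have : g r @[r --> 0^'+] --> B `^ (p - 2) * (B * j.+2%:R) * 0.
    by apply: cvgMr; apply: powR_cvg0; rewrite subr_gt0.
  by rewrite mulr0.
Unshelve. all: by end_near. Qed.

Lemma modulus_monomial (R : realType) (A : R) n : 0 <= A ->
  modulus (fun r => A * r ^+ n.+2).
Proof.
move=> A0; split.
- apply: continuous_subspaceT => x; apply: cvgM; first exact: cvg_cst.
  exact: exprn_continuous.
- by move=> r r0; rewrite mulr_ge0// exprn_ge0.
- apply: (@cvg_trans _ ((A * r ^+ n.+1) @[r --> (0:R)^'+])).
    apply: near_eq_cvg; near=> r.
    have r0 : 0 < r by near: r; exact: nbhs_right_gt.
    by rewrite [r ^+ n.+2]exprS; field; exact: lt0r_neq0.
  have : (A * r ^+ n.+1) @[r --> (0:R)^'+] --> A * 0 ^+ n.+1.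
    by apply: cvgMr; apply: cvg_at_right_filter; exact: exprn_continuous.
  by rewrite expr0n mulr0.
Unshelve. all: by end_near. Qed.

Lemma exprnD_le (R : realType) (a b : R) n : 0 <= a -> 0 <= b ->
  (a + b) ^+ n <= 2 ^+ n * (a ^+ n + b ^+ n).
Proof.
move=> a0 b0; wlog ab : a b a0 b0 / a <= b => [H|].
  by have [/H|/ltW/H] := leP a b; [exact|rewrite [b + a]addrC [b ^+ _ + _]addrC; exact].
apply: (@le_trans _ _ ((2 * b) ^+ n)).
  by apply: lerXn2r; rewrite ?nnegrE ?addr_ge0 ?mulr_ge0//; lra.
rewrite exprMn ler_wpM2l ?exprn_ge0// lerDr exprn_ge0//.
Qed.

Section BarrierAdmissible.
Context (R : realType) (N : nat) (e : 'rV[R]_N) (ep al k1 c M kap lam : R).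
Context (j : nat) (p : R).
Context (M_gt0 : 0 < M) (al_gt0 : 0 < al) (al_le1 : al <= 1).
Context (ep_ge0 : 0 <= ep) (c_ge0 : 0 <= c).
(* The critical point e / ep of the paraboloid lies where the profile does not
   exceed the threshold k1. *)
Context (grad_neq0 :
  forall x, k1 < profile al (paraboloid e ep x) -> 0 < enorm (e - ep *: x)).

Local Notation sg := (paraboloid e ep).
Local Notation slackB := (slack al k1 c).
Local Notation barrierB := (barrier e ep al k1 c M kap lam j).

Lemma slack_le0_critical (t : R) (x : 'rV[R]_N) : 0 <= t ->
  grad (barrierB t) x = 0 -> slackB t (sg x) <= 0.
Proof.
move=> t0 /(congr1 (@enorm R N)); rewrite grad_barrier enormZ normrN.
have -> : enorm (0 : 'rV[R]_N) = 0.
  by rewrite /enorm big1 ?sqrtr0// => i _; rewrite mxE expr0n.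
move=> /eqP; rewrite mulf_eq0 normr_eq0 => H; rewrite leNgt; apply/negP => Y0.
have k1lt : k1 < profile al (sg x).
  by move: Y0; rewrite /slack; have := clock_ge0 c_ge0 t0; lra.
move: H; rewrite !gt_eqF//; first exact: grad_neq0.
exact: (slope_gt0 j M_gt0 al_gt0 Y0).
Qed.

(** At a critical point the slack is nonpositive, and the slack is Lipschitz; hence
    its positive part is O(|x - x0| + |t - t0|) and the barrier, which involves the
    n-th power of the positive part, is flat to order n. *)
Lemma barrier_admissible : 1 < j.+2%:R * (p - 1) -> admissible p barrierB.
Proof.
move=> jp; split.
  apply: Ck_on_subset (Ck_on_barrier _ _ _ _ _ _ _ _ _) => z z0 /=.
  by rewrite ltr_pwDl// mulr_ge0// ltW.
move=> p2 t0 x0 t0_gt0 gr0.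
have Y0 := slack_le0_critical (ltW t0_gt0) gr0.
pose L := 3 * (enorm (e - ep *: x0) + ep) + 2 * c + 1.
have L0 : 0 < L.
  by rewrite ltr_wpDl// addr_ge0// ?mulr_ge0// addr_ge0// enorm_ge0.
pose A := M * (L ^+ j.+3 * 2 ^+ j.+3).
have A0 : 0 < A by apply: mulr_gt0 => //; apply: mulr_gt0; apply: exprn_gt0.
exists 1, (fun r => A * r ^+ j.+3), (fun r => A * r ^+ j.+3); split.
- exact: ltr01.
- exact: flat_class_monomial.
- exact/modulus_monomial/ltW.
move=> t x t_gt0 near0.
have d0 := enorm_ge0 (x - x0); have s0 := normr_ge0 (t - t0).
have ct : 0 < 1 + c * t0 by rewrite ltr_pwDl// mulr_ge0// ltW.
have [_ Dt] := is_derive_barrier_time e ep al k1 M kap lam j x0 ct.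
rewrite derive1E Dt !(pospow0 _ Y0) /barrier /planar !(pospow0 _ Y0).
rewrite !(mulr0, mul0r, subr0, add0r).
have -> : M * pospow j.+3 (slackB t (sg x)) + (kap + lam * t) - (kap + lam * t0)
  - lam * (t - t0) = M * pospow j.+3 (slackB t (sg x)) by ring.
rewrite ger0_norm; last by apply: mulr_ge0; [exact: ltW|exact: pospow_ge0].
rewrite -mulrDr /A -mulrA ler_pM2l//.
have LD : 0 <= L * (enorm (x - x0) + `|t - t0|).
  by apply: mulr_ge0; [exact: ltW|exact: addr_ge0].
apply: (@le_trans _ _ ((L * (enorm (x - x0) + `|t - t0|)) ^+ j.+3)); last first.
  rewrite exprMn -mulrA; apply: ler_wpM2l; last exact: exprnD_le.
  by apply: exprn_ge0; exact: ltW.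
rewrite -(pospowE _ LD); apply: ler_pospow.
have Y1 : slackB t (sg x) - slackB t0 (sg x0) <=
    3 * `|sg x - sg x0| + 2 * c * `|t - t0|.
  have := profile_lipschitz (sg x) (sg x0) (ltW al_gt0) al_le1.
  have := clock_lipschitz c_ge0 (ltW t_gt0) (ltW t0_gt0).
  by rewrite /slack; lra.
have Y2 : `|sg x - sg x0| <= (enorm (e - ep *: x0) + ep) * enorm (x - x0).
  by apply: paraboloid_lipschitz => //; lra.
have g0 := enorm_ge0 (e - ep *: x0).
have : 0 <= (enorm (e - ep *: x0) + ep) * `|t - t0| by rewrite mulr_ge0// addr_ge0.
have : 0 <= c * enorm (x - x0) by rewrite mulr_ge0.
by rewrite /L; lra.
Qed.

End BarrierAdmissible.

(** * Diffusion and decay against absorption *)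

(** With P = A Y^m kp the slope of the barrier and G the length of the gradient of
    the paraboloid, the two sides are compared after division by (P G)^q: the
    remaining power Y^(m (p - 1 - q)) is at most Y and cancels the singularity
    D / Y. *)
Lemma diffusion_le_absorption (R : realType) (p q A Y kp G l D : R) m :
  q < p - 1 -> 1 <= m%:R * (p - 1 - q) ->
  0 < A -> 0 < Y -> Y <= 1 -> 0 < kp -> kp <= 4 -> 0 < G -> G <= 2 * l ->
  0 < D -> (4 * A) `^ (p - 1 - q) * (2 * l) `^ (p - q) * D <= 1 / 2 ->
  (A * Y ^+ m * kp) `^ (p - 1) * G `^ p * (D / Y) <=
  (A * Y ^+ m * kp * G) `^ q / 2.
Proof.
move=> qp mp A0 Y0 Y1 kp0 kp4 G0 Gl D0 small.
have Ym0 : 0 < Y ^+ m by rewrite exprn_gt0.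
set P := A * Y ^+ m * kp.
have P0 : 0 < P by rewrite !mulr_gt0.
have Pn0 : P != 0 by exact: lt0r_neq0.
have Gn0 : G != 0 by exact: lt0r_neq0.
have Yn0 : Y != 0 by exact: lt0r_neq0.
have -> : P `^ (p - 1) = P `^ q * P `^ (p - 1 - q).
  by rewrite -powRD ?Pn0 ?implybT//; congr (_ `^ _); ring.
have -> : G `^ p = G `^ q * G `^ (p - q).
  by rewrite -powRD ?Gn0 ?implybT//; congr (_ `^ _); ring.
rewrite powRM ?(ltW P0) ?(ltW G0)//.
rewrite (_ : _ * _ = P `^ q * G `^ q * (P `^ (p - 1 - q) * G `^ (p - q) * (D / Y)));
  last by ring.
apply: ler_wpM2l; first by rewrite mulr_ge0// powR_ge0.
have HP : P `^ (p - 1 - q) <= (4 * A) `^ (p - 1 - q) * Y.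
  apply: (@le_trans _ _ ((4 * A * Y ^+ m) `^ (p - 1 - q))).
    apply: ge0_ler_powR; [by rewrite subr_ge0 ltW|by rewrite nnegrE ltW|
      by rewrite nnegrE ltW// !mulr_gt0|].
    by rewrite /P -[leRHS]mulrA [leRHS]mulrC; apply: ler_wpM2l;
      [rewrite mulr_ge0// ltW|].
  rewrite powRM ?mulr_ge0 ?(ltW A0) ?(ltW Ym0)//.
  apply: ler_wpM2l; first exact: powR_ge0.
  rewrite -powR_mulrn ?(ltW Y0)// -powRrM -[leRHS](powRr1 (ltW Y0)).
  by apply: ger_powR => //; rewrite Y0.
have HG : G `^ (p - q) <= (2 * l) `^ (p - q).
  apply: ge0_ler_powR; rewrite ?nnegrE ?(ltW G0)//.
    by rewrite subr_ge0; lra.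
  by rewrite (le_trans (ltW G0)).
rewrite div1r in small; apply: le_trans small.
apply: (@le_trans _ _ (((4 * A) `^ (p - 1 - q) * Y) * (2 * l) `^ (p - q) * (D / Y))).
  apply: ler_wpM2r; first by rewrite divr_ge0// ltW.
  by apply: ler_pM => //; exact: powR_ge0.
by rewrite le_eqVlt; apply/orP; left; apply/eqP; field.
Qed.

(** The left-hand side bounds the speed at which the barrier decreases. Dividing by
    the power q of W = A Y^m leaves Y^(m (1 - q)), which is at most
    (k h)^q = k^((1 + 1/al) q) because Y <= k and Y <= 1: here the rate of decay
    at infinity and the condition on theta meet. *)
Lemma decay_le_absorption (R : realType) (q al A Y k h kp b G l c : R) m :
  0 < q -> q < 1 -> 0 < al -> (1 + al^-1) * q <= m%:R * (1 - q) ->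
  0 < A -> 0 < Y -> Y <= 1 -> 0 < h -> k = h `^ al -> Y <= k ->
  0 < b -> b * (k * h) <= kp -> 0 < l -> l / 2 <= G -> 0 <= c ->
  4 * c * A `^ (1 - q) <= (b * (l / 2)) `^ q ->
  A * Y ^+ m * (2 * c) <= (A * Y ^+ m * kp * G) `^ q / 2.
Proof.
move=> q0 q1 al0 mq A0 Y0 Y1 h0 kE Yk b0 kpb l0 Gl c0 small.
have Ym0 : 0 < Y ^+ m by rewrite exprn_gt0.
set W := A * Y ^+ m.
have W0 : 0 < W by rewrite mulr_gt0.
have k0 : 0 < k by rewrite kE powR_gt0.
have kh0 : 0 < k * h by rewrite mulr_gt0.
have HY : (Y ^+ m) `^ (1 - q) <= (k * h) `^ q.
  rewrite -powR_mulrn ?(ltW Y0)// -powRrM.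
  apply: (@le_trans _ _ (Y `^ ((1 + al^-1) * q))).
    by apply: ger_powR => //; rewrite Y0.
  rewrite powRrM; apply: ge0_ler_powR; rewrite ?nnegrE ?powR_ge0 ?(ltW kh0) ?(ltW q0)//.
  have -> : k * h = k `^ (1 + al^-1).
    rewrite powRD; last by rewrite (lt0r_neq0 k0) implybT.
    rewrite powRr1 ?(ltW k0)//; congr (_ * _).
    by rewrite kE -powRrM divff ?lt0r_neq0// powRr1// ltW.
  apply: ge0_ler_powR; rewrite ?nnegrE ?(ltW Y0) ?(ltW k0)//.
  by rewrite addr_ge0// invr_ge0 ltW.
have -> : W * (2 * c) = W `^ q * (W `^ (1 - q) * (2 * c)).
  rewrite [RHS]mulrA -powRD; last by rewrite (lt0r_neq0 W0) implybT.
  by rewrite (_ : q + (1 - q) = 1) ?powRr1 ?(ltW W0)//; ring.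
have kp0 : 0 < kp by rewrite (lt_le_trans _ kpb)// mulr_gt0.
have G0 : 0 < G by rewrite (lt_le_trans _ Gl)// divr_gt0.
rewrite -(mulrA W) powRM ?(ltW W0) ?mulr_ge0 ?(ltW kp0) ?(ltW G0)// -mulrA.
apply: ler_wpM2l; first exact: powR_ge0.
have HK : (b * (l / 2)) `^ q * (k * h) `^ q <= (kp * G) `^ q.
  rewrite -powRM ?(ltW kh0) ?mulr_ge0 ?(ltW b0) ?(ltW l0)//.
  apply: ge0_ler_powR; rewrite ?nnegrE ?mulr_ge0 ?(ltW kp0) ?(ltW G0) ?(ltW q0)
    ?(ltW b0) ?(ltW l0) ?(ltW k0) ?(ltW h0)//.
  rewrite mulrAC; apply: ler_pM => //; first by rewrite ltW// mulr_gt0.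
  by rewrite ltW// divr_gt0.
have HW : W `^ (1 - q) <= A `^ (1 - q) * (k * h) `^ q.
  rewrite (powRM _ (ltW A0) (ltW Ym0)).
  by apply: ler_wpM2l; first exact: powR_ge0.
have khq : 0 <= (k * h) `^ q by exact: powR_ge0.
have c20 : 0 <= 2 * c by rewrite mulr_ge0.
have S1 := ler_wpM2r c20 HW.
have S2 := ler_wpM2r khq small.
lra.
Qed.

(** * Comparison with the barrier *)

Lemma exists_max_half_space (R : realType) N (D : R -> 'rV[R]_N -> R)
    (ts T r : R) (xs : 'rV[R]_N) :
  {within [set z : R * 'rV[R]_N | 0 <= z.1], continuous (uncurried D)} ->
  0 <= ts ->
  (forall t x, 0 <= t -> D ts xs <= D t x -> t <= T /\ enorm x <= r) ->
  exists t0 x0, 0 <= t0 /\ forall t x, 0 <= t -> D t x <= D t0 x0.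
Proof.
move=> cD ts0 coer.
pose K := `[0, T]%classic `*`
  [set v : 'rV[R]_N | forall i, `[- r, r]%classic (v ord0 i)].
have inK t x : 0 <= t -> D ts xs <= D t x -> K (t, x).
  move=> t0 /(coer _ _ t0)[tT xr]; split => /=; first by rewrite in_itv/= t0.
  move=> i; rewrite /= in_itv/= -ler_norml; exact: le_trans (enorm_coord x i) xr.
have cK : compact K.
  apply: compact_setX; first exact: segment_compact.
  by apply: (@rV_compact _ _ (fun=> `[- r, r]%classic)) => i; exact: segment_compact.
have Ks : K (ts, xs) by exact: inK.
have cDK : {within K, continuous (uncurried D)}.
  by apply: continuous_subspaceW cD => -[t x] [/= + _]; rewrite in_itv/= => /andP[].
have [|[t0 x0]] := @compact_EVT_max _ R (uncurried D) K _ cK cDK.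
  by exists (ts, xs).
rewrite inE => -[/= + _] Hmax; rewrite in_itv/= => /andP[t00 _].
have Dmax : D ts xs <= D t0 x0 by apply: (Hmax (ts, xs)); rewrite inE.
exists t0, x0; split=> // t x tge0; have [le|lt] := leP (D ts xs) (D t x).
  by apply: (Hmax (t, x)); rewrite inE; exact: inK.
exact: le_trans (ltW lt) Dmax.
Qed.

Lemma exprn_sub_le (R : realType) (z x : R) n : 0 <= z -> z <= x -> x <= 1 ->
  x ^+ n <= z ^+ n + n%:R * (x - z).
Proof.
move=> z0 zx x1; have x0 := le_trans z0 zx; elim: n => [|n IH].
  by rewrite !expr0 mul0r addr0.
rewrite !exprS -natr1.
have zn : z ^+ n <= 1 by rewrite exprn_ile1// (le_trans zx).
have H1 := ler_wpM2l x0 IH.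
have H2 : 0 <= (1 - x) * (n%:R * (x - z)).
  by apply: mulr_ge0; rewrite ?subr_ge0// mulr_ge0// subr_ge0.
have H3 : 0 <= (1 - z ^+ n) * (x - z) by rewrite mulr_ge0// subr_ge0.
lra.
Qed.

Section Comparison.
Context (R : realType) (N : nat) (p q : R) (u : R -> 'rV[R]_N -> R).
Context (e : 'rV[R]_N) (al c M lam s1 : R) (j : nat).
Context (p_le2 : p <= 2) (q_gt0 : 0 < q) (q_ltp : q < p - 1).
Context (al_gt0 : 0 < al) (al_le1 : al <= 1).
Context (j_diff : 1 <= j.+2%:R * (p - 1 - q)).
Context (j_abs : (1 + al^-1) * q <= j.+2%:R * (1 - q)).
Context (M_gt0 : 0 < M) (lam_gt0 : 0 < lam).

(* B bounds recip s where profile al s <= 4; the value of ep places the critical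
   point of the paraboloid on its level set 2 s1, while k1 is the value of the
   profile at s1; kap makes up for k1 at time 0. *)
Let B : R := 4 `^ al^-1.
Let l := enorm e.
Let A := M * j.+3%:R.
Let ep := l ^+ 2 / (4 * s1).
Let k1 := profile al s1.
Let kap := M * (j.+3%:R * k1).

Context (l_gt0 : 0 < l) (l_le1 : l <= 1).
Context (l_small :
  (4 * A) `^ (p - 1 - q) * (2 * l) `^ (p - q) * (4 * j.+2%:R + 3) <= 1 / 2).
Context (c_gt0 : 0 < c).
Context (c_small :
  4 * c * A `^ (1 - q) <= (2 * al / (1 + B ^+ 2) * (l / 2)) `^ q).
Context (s1_gt0 : 0 < s1) (s1_geN : N%:R <= s1) (s1_geB : B <= s1).

Context (u_cont :
  {within [set z : R * 'rV[R]_N | 0 <= z.1], continuous (uncurried u)}).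
Context (u_le : forall t x, 0 <= t -> u t x <= M).
Context (u_init : forall x, u 0 x <= M * profile al (enorm x) ^+ j.+3).
Context (u_sub : visc_subsolution p q u).

Local Notation sg := (paraboloid e ep).
Local Notation slackB := (slack al k1 c).
Local Notation slopeB := (slope al k1 c M j).
Local Notation psi := (barrier e ep al k1 c M kap lam j).

Let ep_gt0 : 0 < ep.
Proof. by rewrite divr_gt0 ?exprn_gt0// mulr_gt0. Qed.

Let k1_gt0 : 0 < k1. Proof. exact: profile_gt0. Qed.

Let k1_le1 : k1 <= 1.
Proof. by rewrite -(profile0 al) /k1 profile_nincr ?ltW. Qed.

Let B_gt0 : 0 < B. Proof. by rewrite powR_gt0. Qed.

Let clock_le2 t : 0 <= t -> clock c t <= 2.
Proof.
move=> t0; rewrite /clock gerBl divr_ge0// addr_ge0// mulr_ge0// ltW//.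
Qed.

Let grad_sg_lower x : k1 < profile al (sg x) ->
  l ^+ 2 / 2 <= enorm (e - ep *: x) ^+ 2.
Proof.
move=> k1s; have ss1 : sg x < s1.
  rewrite ltNge; apply/negP => /(profile_nincr (ltW al_gt0)).
  by rewrite leNgt k1s.
rewrite enorm_grad_paraboloid2 -/l.
have : 2 * ep * sg x <= 2 * ep * s1 by apply: ler_wpM2l; [rewrite mulr_ge0// ltW|exact: ltW].
have -> : 2 * ep * s1 = l ^+ 2 / 2 by rewrite /ep; field; exact: lt0r_neq0.
lra.
Qed.

Let grad_sg_gt0 x : k1 < profile al (sg x) -> 0 < enorm (e - ep *: x).
Proof.
move=> /grad_sg_lower H; rewrite lt_def enorm_ge0 andbT; apply/eqP => g0.
move: H; rewrite g0 expr0n/= => H; have := exprn_gt0 2 l_gt0; lra.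
Qed.

(* Only the region where the barrier is below the bound M of u matters; there the
   slack is below 1, hence the profile is at most 1 + k1 + 2 <= 4. *)
Let psi_lt t x : 0 <= t -> psi t x < M ->
  [/\ lam * t < M, slackB t (sg x) < 1 & recip (sg x) <= B].
Proof.
move=> t0; rewrite /barrier /planar => H.
have kap0 : 0 < kap by rewrite mulr_gt0// mulr_gt0// ltr0n.
have w0 : 0 <= M * pospow j.+3 (slackB t (sg x)).
  by rewrite mulr_ge0 ?pospow_ge0// ltW.
have lt0' : 0 <= lam * t by rewrite mulr_ge0// ltW.
have Y1 : slackB t (sg x) < 1.
  rewrite ltNge; apply/negP => Y1.
  have : 1 <= pospow j.+3 (slackB t (sg x)).
    by rewrite pospowE ?exprn_ege1// (le_trans _ Y1).
  move=> Z; have : M <= M * pospow j.+3 (slackB t (sg x)) by rewrite ler_peMr// ltW.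
  lra.
split => //; first lra.
have k4 : profile al (sg x) <= 4.
  by move: Y1; rewrite /slack; have := clock_le2 t0; have := k1_le1; lra.
have -> : recip (sg x) = profile al (sg x) `^ al^-1.
  by rewrite /profile -powRrM divff ?lt0r_neq0// powRr1// ltW// recip_gt0.
apply: ge0_ler_powR; rewrite ?nnegrE ?(ltW (profile_gt0 _ _))// invr_ge0 ltW//.
Qed.

Let barrier_strict t x : 0 < t -> psi t x < M -> 0 < slackB t (sg x) ->
  plap p (psi t) x - enorm (grad (psi t) x) `^ q < derive1 (psi^~ x) t.
Proof.
move=> t0 psiM Y0; have [_ Y1 hB] := psi_lt (ltW t0) psiM.
set s := sg x in Y0 Y1 hB.
have k1s : k1 < profile al s.
  by move: Y0; rewrite /slack; have := clock_ge0 (ltW c_gt0) (ltW t0); lra.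
have G2 := grad_sg_lower k1s; have G0 := grad_sg_gt0 k1s.
set G := enorm (e - ep *: x) in G2 G0.
have G2p : 0 < G ^+ 2 by rewrite exprn_gt0.
have GU : G <= 2 * l.
  have Gs : G ^+ 2 = l ^+ 2 - 2 * ep * s by exact: enorm_grad_paraboloid2.
  have sB : - s <= B := le_trans (recip_geN s) hB.
  have : 2 * ep * (- s) <= 2 * ep * s1.
    by apply: ler_wpM2l; [rewrite mulr_ge0// ltW|exact: le_trans sB s1_geB].
  have -> : 2 * ep * s1 = l ^+ 2 / 2 by rewrite /ep; field; exact: lt0r_neq0.
  move=> H; have l2 := exprn_gt0 2 l_gt0.
  have : G ^+ 2 <= (2 * l) ^+ 2 by rewrite exprMn; lra.
  by rewrite ler_sqr ?nnegrE ?mulr_ge0 ?(ltW l_gt0) ?(ltW G0).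
have GL : l / 2 <= G.
  rewrite -ler_sqr ?nnegrE ?divr_ge0 ?(ltW l_gt0) ?(ltW G0)//.
  rewrite expr_div_n; have l2 := exprn_gt0 2 l_gt0; lra.
have v1 := hypot_ge1 s; have k0 := profile_gt0 al s; have v0 := hypot_gt0 s.
set kp := al * profile al s / hypot s.
have kp0 : 0 < kp by rewrite divr_gt0// mulr_gt0.
have k4 : profile al s <= 4.
  by move: Y1; rewrite /slack; have := clock_le2 (ltW t0); have := k1_le1; lra.
have kp4 : kp <= 4.
  rewrite /kp ler_pdivrMr//.
  have : al * profile al s <= 1 * profile al s by rewrite ler_wpM2r// ltW.
  lra.
set Y := slackB t s in Y0 Y1.
have A0 : 0 < A by rewrite mulr_gt0// ltr0n.
have SE : slopeB t s = A * Y ^+ j.+2 * kp by rewrite /slope pospowE// ltW.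
have S0 : 0 < slopeB t s by exact: slope_gt0.
have q1 : q < 1 by have := q_ltp; have := p_le2; lra.
have Yk : Y <= profile al s.
  by rewrite /Y /slack; have := clock_ge0 (ltW c_gt0) (ltW t0); have := k1_gt0; lra.
(* Half of the absorption term pays for the diffusion. *)
have p1 : 1 < p by have := q_ltp; have := q_gt0; lra.
have D1 : plap p (psi t) x <= (slopeB t s * G) `^ q / 2.
  apply: le_trans (@plap_barrier_le _ _ e ep al k1 c M kap lam j p M_gt0 al_gt0
    (ltW ep_gt0) p1 p_le2 t x Y0 G2p) _.
  rewrite -/s -/G -/kp -/Y.
  have FE : flux e ep al k1 c M j p t s * G ^+ 2 = slopeB t s `^ (p - 1) * G `^ p.
    rewrite /flux -enorm_grad_paraboloid2 -/G -mulrA; congr (_ * _).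
    rewrite -powR_mulrn ?(ltW G0)// -powRrM -powRD; last first.
      by rewrite (lt0r_neq0 G0) implybT.
    by congr (_ `^ _); field.
  have F0 : 0 <= flux e ep al k1 c M j p t s by rewrite mulr_ge0// powR_ge0.
  apply: (@le_trans _ _ (slopeB t s `^ (p - 1) * G `^ p * ((4 * j.+2%:R + 3) / Y))).
    rewrite -FE -[leRHS]mulrA; apply: ler_wpM2l => //.
    have epN : ep * N%:R <= G ^+ 2.
      apply: (@le_trans _ _ (ep * s1)); first by rewrite ler_wpM2l// ltW.
      have -> : ep * s1 = l ^+ 2 / 4 by rewrite /ep; field; exact: lt0r_neq0.
      have l2 := exprn_gt0 2 l_gt0; lra.
    have Z1 : al / hypot s + s / hypot s ^+ 2 <= 2.
      have : al / hypot s <= 1 by rewrite ler_pdivrMr//; have := al_le1; lra.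
      have : s / hypot s ^+ 2 <= 1.
        rewrite ler_pdivrMr ?exprn_gt0// mul1r.
        have := hypot_gt_norm s; rewrite ltr_norml => /andP[_ sv].
        by rewrite (le_trans (ltW sv))// ler_eXnr.
      lra.
    have jY : j.+2%:R * kp / Y <= 4 * j.+2%:R / Y.
      rewrite ler_pM2r ?invr_gt0// mulrC ler_wpM2r//.
    have jp0 : 0 <= j.+2%:R * kp / Y by apply: divr_ge0; [rewrite mulr_ge0// ltW|exact: ltW].
    have Yi : 1 <= Y^-1 by rewrite invf_ge1// ltW.
    have s2 : 0 <= al / hypot s + s / hypot s ^+ 2 + 1.
      have : -1 <= s / hypot s ^+ 2.
        rewrite ler_pdivlMr ?exprn_gt0// mulN1r.
        have := hypot_gt_norm s; rewrite ltr_norml => /andP[sv _].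
        have : hypot s <= hypot s ^+ 2 by rewrite ler_eXnr.
        lra.
      have : 0 <= al / hypot s by apply: divr_ge0; exact: ltW.
      lra.
    set Z := al / hypot s + s / hypot s ^+ 2 in Z1 s2.
    rewrite -addrA -/Z.
    apply: (@le_trans _ _ (G ^+ 2 * (j.+2%:R * kp / Y + 3))).
      have : (p - 1) * (j.+2%:R * kp / Y + Z) <= j.+2%:R * kp / Y + 2.
        have : 0 <= (2 - p) * (j.+2%:R * kp / Y) by rewrite mulr_ge0// subr_ge0.
        have : 0 <= (p - 1) * (2 - Z) by apply: mulr_ge0; rewrite subr_ge0// ltW.
        by have := p_le2; lra.
      move=> /(ler_wpM2l (ltW G2p)); lra.
    by rewrite ler_pM2l// [leRHS]mulrDl; apply: lerD jY _; rewrite ler_peMr.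
  rewrite SE; apply: (diffusion_le_absorption (l := l)) => //.
  exact: ltW.
(* The other half pays for the decrease of the barrier. *)
have D2 : A * Y ^+ j.+2 * (2 * c) <= (slopeB t s * G) `^ q / 2.
  rewrite SE; apply: (@decay_le_absorption _ q al A Y (profile al s) (recip s) kp
    (2 * al / (1 + B ^+ 2)) G l c) => //.
  - exact: ltW.
  - exact: recip_gt0.
  - by rewrite divr_gt0 ?mulr_gt0// ltr_pwDl// exprn_ge0// ltW.
  - exact: profile_slope_lower (ltW al_gt0) hB.
  - exact: ltW.
have ct : 1 <= 1 + c * t by rewrite lerDl mulr_ge0 ?ltW.
have ct0 : 0 < 1 + c * t by rewrite (lt_le_trans ltr01).
have [_ Dt] := is_derive_barrier_time e ep al k1 M kap lam j x ct0.
rewrite derive1E Dt -/s -/Y pospowE ?(ltW Y0)// -/A.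
have Wt : A * Y ^+ j.+2 * (2 * c / (1 + c * t) ^+ 2) <= A * Y ^+ j.+2 * (2 * c).
  apply: ler_wpM2l; first by rewrite mulr_ge0 ?exprn_ge0// ltW.
  rewrite ler_pdivrMr ?exprn_gt0// ler_peMr ?mulr_ge0 ?(ltW c_gt0)//.
  exact: exprn_ege1.
rewrite grad_barrier enormZ normrN (ger0_norm (ltW S0)) -/s -/G.
by have := lam_gt0; lra.
Qed.

Let init_le x : u 0 x <= psi 0 x.
Proof.
have c0 : clock c 0 = 0 by rewrite /clock mulr0 addr0 divr1 subrr.
rewrite /barrier /planar /slack c0 subr0 mulr0 addr0 /kap -mulrDr.
have ks : profile al (enorm x) <= profile al (sg x).
  apply: profile_nincr; first exact: ltW.
  apply: le_trans (paraboloid_le _ _ _) _; rewrite -/l.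
  have lx : l * enorm x <= 1 * enorm x.
    by apply: ler_wpM2r; [exact: enorm_ge0|exact: l_le1].
  have : 0 <= ep / 2 * enorm x ^+ 2.
    by apply: mulr_ge0; [rewrite divr_ge0// ltW|rewrite exprn_ge0// enorm_ge0].
  lra.
have kx := profile_gt0 al (enorm x).
have kx1 : profile al (enorm x) <= 1.
  by rewrite -(profile0 al) profile_nincr ?enorm_ge0// ltW.
set k := profile al (enorm x) in ks kx kx1.
apply: le_trans (u_init x) _; rewrite ler_pM2l// -/k.
apply: (@le_trans _ _ (pospow j.+3 (k - k1) + j.+3%:R * k1)); last first.
  by rewrite lerD2r; apply: ler_pospow; rewrite lerD2r.
have [kk|kk] := leP k k1.
  rewrite pospow0 ?subr_le0// add0r.
  apply: (@le_trans _ _ k); first by rewrite exprS ler_piMr ?exprn_ile1 ?(ltW kx).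
  by rewrite (le_trans kk)// ler_peMl ?ler1n// ltW.
rewrite pospowE ?subr_ge0 ?(ltW kk)//.
have := @exprn_sub_le _ (k - k1) k j.+3; rewrite subKr; apply.
- by rewrite subr_ge0 ltW.
- by rewrite gerBl ltW.
- exact: kx1.
Qed.

Let psi_coercive t x : 0 <= t -> psi t x < M ->
  t <= M / lam /\ enorm x <= 2 / ep * (l + B) + 1.
Proof.
move=> t0 /(psi_lt t0)[lt _ hB]; split.
  by rewrite ler_pdivlMr// mulrC ltW.
have := paraboloid_le e ep x; rewrite -/l => H1.
have sB : - sg x <= B := le_trans (recip_geN _) hB.
have H2 : ep / 2 * enorm x ^+ 2 <= l * enorm x + B by lra.
rewrite leNgt; apply/negP => H3.
have ep0 := ep_gt0; have B0 := B_gt0.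
have x1 : 1 < enorm x.
  apply: le_lt_trans H3; rewrite lerDr; apply: mulr_ge0.
    by rewrite divr_ge0// ltW.
  by rewrite addr_ge0// ltW.
have xP : 0 < enorm x by rewrite (lt_trans ltr01).
have : (l + B) * enorm x < ep / 2 * enorm x ^+ 2.
  rewrite expr2 mulrA ltr_pM2r//.
  rewrite (_ : l + B = ep / 2 * (2 / ep * (l + B))); last first.
    by field; exact: lt0r_neq0.
  rewrite ltr_pM2l; last by rewrite (divr_gt0 ep0).
  by apply: lt_trans H3; rewrite ltrDl.
have H4 : B <= B * enorm x by rewrite ler_peMr// ltW.
rewrite mulrDl => H5; have := lt_le_trans H5 H2.
by rewrite ltrD2l ltNge H4.
Qed.

Let psi_cont :
  {within [set z : R * 'rV[R]_N | 0 <= z.1], continuous (uncurried psi)}.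
Proof.
apply: continuous_in_subspaceT => z; rewrite inE => z0.
apply: (Ck_on_continuous (Ck_on_barrier e ep al k1 c M kap lam j)).
by rewrite /= ltr_pwDl// mulr_ge0// ltW.
Qed.

(** The term lam t makes u - psi coercive in time, and makes the inequality strict
    where the barrier does not depend on x. *)
Lemma le_barrier t x : 0 < t -> u t x <= psi t x.
Proof.
move=> t0; rewrite leNgt; apply/negP => D0.
pose D t x := u t x - psi t x.
have cD : {within [set z : R * 'rV[R]_N | 0 <= z.1], continuous (uncurried D)}.
  by move=> z; apply: cvgB; [exact: u_cont|exact: psi_cont].
have pos t' x' : 0 <= t' -> D t x <= D t' x' -> psi t' x' < u t' x'.
  by move=> t'0; rewrite /D; move: D0; lra.
have [t1 x1 t1_0 H|t1 [x1 [t1_ge0 Dmax]]] :=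
  @exists_max_half_space _ _ D t (M / lam) (2 / ep * (l + B) + 1) x cD (ltW t0).
  by apply: psi_coercive => //; exact: lt_le_trans (pos _ _ t1_0 H) (u_le _ t1_0).
have D1 := pos _ _ t1_ge0 (Dmax _ _ (ltW t0)).
have t1_gt0 : 0 < t1.
  rewrite lt_def t1_ge0 andbT; apply/eqP => t1E; move: D1; rewrite t1E ltNge.
  by rewrite init_le.
have psiM : psi t1 x1 < M := lt_le_trans D1 (u_le _ t1_ge0).
have p1 : 1 < p by have := q_gt0; have := q_ltp; lra.
have adm : admissible p psi.
  apply: barrier_admissible => //; [exact: ltW|exact: ltW|].
  apply: (le_lt_trans j_diff).
  by rewrite ltr_pM2l ?ltr0n// ltrBlDr ltrDl.
have := u_sub adm t1_gt0 (fun t' x' t'0 => Dmax t' x' (ltW t'0)).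
have [Y0|Y0] := leP (slackB t1 (sg x1)) 0.
(* At a critical point the equation would give lam <= 0. *)
  have ct : 0 < 1 + c * t1 by rewrite ltr_pwDl// mulr_ge0// ltW.
  have [_ Dt] := is_derive_barrier_time e ep al k1 M kap lam j x1 ct.
  rewrite derive1E Dt (pospow0 _ Y0) mulr0 mul0r subr0.
  have gr0 : grad (psi t1) x1 = 0.
    by rewrite grad_barrier /slope (pospow0 _ Y0) mulr0 mul0r oppr0 scale0r.
  have en0 : enorm (0 : 'rV[R]_N) = 0.
    by rewrite -(scale0r (0 : 'rV[R]_N)) enormZ normr0 mul0r.
  rewrite /visc_rhs gr0 eqxx andbT; case: ifPn => [_|]; first by have := lam_gt0; lra.
  rewrite -leNgt => p2; have pE : p = 2 by apply/eqP; rewrite eq_le p_le2.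
  rewrite plap2_barrier0//.
  by rewrite en0 powR0 ?lt0r_neq0// subr0; have := lam_gt0; lra.
have := barrier_strict t1_gt0 psiM Y0.
rewrite /visc_rhs ifF; first by move=> h1 h2; have := lt_le_trans h1 h2; rewrite ltxx.
apply/negbTE; rewrite negb_and; apply/orP; right; apply/eqP => gr0.
have := slack_le0_critical M_gt0 al_gt0 (ltW c_gt0) grad_sg_gt0 (ltW t1_gt0) gr0.
by rewrite leNgt Y0.
Qed.

End Comparison.

(** * Vanishing of the solution *)

Lemma exists_aligned (R : realType) N (x : 'rV[R]_N) (l : R) : (1 <= N)%N ->
  0 <= l -> exists2 e : 'rV[R]_N, enorm e = l &
  \sum_i e 0 i * x 0 i = l * enorm x.
Proof.
move=> N1 l0; have [x0|xn0] := eqVneq (enorm x) 0.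
  exists (l *: basis_vec R (Ordinal N1)).
    rewrite enormZ ger0_norm// /enorm (bigD1 (Ordinal N1))//= big1.
      by rewrite addr0 mxE !eqxx expr1n sqrtr1 mulr1.
    by move=> i ni; rewrite mxE (negbTE ni) andbF expr0n.
  rewrite x0 mulr0 big1// => i _.
  have : `|x 0 i| <= 0 by rewrite -x0; exact: enorm_coord.
  by rewrite normr_le0 => /eqP ->; rewrite mulr0.
exists ((l / enorm x) *: x).
  by rewrite enormZ ger0_norm ?divr_ge0 ?enorm_ge0// divfK.
under eq_bigr do rewrite mxE -mulrA -expr2.
by rewrite -mulr_sumr -enorm_sqr expr2 mulrA divfK.
Qed.

(** The factor 2^theta accounts for recip X ~ 1 / (2 X) at infinity. *)
Lemma decay_le_profile (R : realType) (C theta X : R) n :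
  0 < C -> 0 < theta -> 0 <= X -> 
  C * (1 + X) `^ (- theta) <=
  2 `^ theta * C * profile (theta / n.+1%:R) X ^+ n.+1.
Proof.
move=> C0 th0 X0; have n0 : n.+1%:R != 0 :> R by rewrite pnatr_eq0.
rewrite -(powR_mulrn n.+1 (ltW (profile_gt0 _ _))) /profile -powRrM divfK//.
rewrite mulrAC [leLHS]mulrC; apply: ler_wpM2r; first exact: ltW.
have -> : 2 `^ theta * recip X `^ theta = (2 * recip X) `^ theta.
  by rewrite powRM// ltW// recip_gt0.
have X1 : 0 < 1 + X by rewrite ltr_pwDl.
rewrite -(mulN1r theta) powRrM powR_inv1 ?(ltW X1)//.
apply: ge0_ler_powR; rewrite ?nnegrE ?invr_ge0 ?(ltW X1) ?(ltW th0)//.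
  by rewrite mulr_ge0// ltW// recip_gt0.
have H := recip_ge X0.
apply: (@le_trans _ _ (2 * (1 + 2 * X)^-1)); last by rewrite ler_pM2l.
rewrite -[2 in leRHS]invrK -invfM lef_pV2 ?posrE//; first lra.
by rewrite mulr_gt0 ?invr_gt0//; lra.
Qed.

(** The barrier is used with e parallel to x, so that the paraboloid is at least
    l |x| / 2 at x when ep |x| <= l: its main part then vanishes at (t, x), and
    the other two terms are at most eta / 2 for s1 large and lam small. *)
Lemma solution_eq0 (R : realType) (N : nat) (p q : R) (u0 : 'rV[R]_N -> R)
    (u : R -> 'rV[R]_N -> R) (al c M l t : R) (j : nat) (x : 'rV[R]_N) :
  (1 <= N)%N -> solution p q u0 u -> p <= 2 -> 0 < q -> q < p - 1 ->
  0 < al -> al <= 1 -> 1 <= j.+2%:R * (p - 1 - q) ->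
  (1 + al^-1) * q <= j.+2%:R * (1 - q) -> 0 < M -> 0 < l -> l <= 1 ->
  (4 * (M * j.+3%:R)) `^ (p - 1 - q) * (2 * l) `^ (p - q) *
    (4 * j.+2%:R + 3) <= 1 / 2 ->
  0 < c ->
  4 * c * (M * j.+3%:R) `^ (1 - q) <=
    (2 * al / (1 + (4 `^ al^-1) ^+ 2) * (l / 2)) `^ q ->
  (forall t x, 0 <= t -> u t x <= M) ->
  (forall x, u0 x <= M * profile al (enorm x) ^+ j.+3) ->
  0 < t -> profile al (l * enorm x / 2) <= clock c t -> u t x = 0.
Proof.
move=> N1 hu p2 q0 qp al0 al1 jd ja M0 l0 l1 lsm c0 csm uM uin t0 tx.
apply/eqP; rewrite eq_le (sol_ge0 hu x (ltW t0)) andbT.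
apply/ler_addgt0Pr => eta eta0; rewrite add0r.
have [e el ex] := exists_aligned x N1 (ltW l0).
have Mj : 0 < M * j.+3%:R by rewrite mulr_gt0// ltr0n.
have etaM : 0 < eta / 2 / (M * j.+3%:R) by rewrite !divr_gt0.
have [S S0 HS] := profile_small al0 etaM.
pose s1 := S + N%:R + 4 `^ al^-1 + enorm x.
have B0 : 0 <= (4 : R) `^ al^-1 by exact: powR_ge0.
have N0 : 0 <= N%:R :> R by exact: ler0n.
have x0 := enorm_ge0 x.
have s1S : S <= s1 by rewrite /s1; lra.
have s10 : 0 < s1 := lt_le_trans S0 s1S.
have lam0 : 0 < eta / 2 / t by rewrite !divr_gt0.
have uin' y : u 0 y <= M * profile al (enorm y) ^+ j.+3.
  by rewrite (sol_init hu).
rewrite -el in l0 l1 lsm csm.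
have := @le_barrier R N p q u e al c M (eta / 2 / t) s1 j p2 q0 qp al0 al1 jd ja
  M0 lam0 l0 l1 lsm c0 csm s10.
move=> /(_ _ _ (sol_continuous hu) uM uin' (sol_sub hu) t x t0) => H.
apply: le_trans (H _ _) _; try by rewrite /s1; lra.
rewrite /barrier /planar el; set sx := paraboloid _ _ _.
have sxl : l * enorm x / 2 <= sx.
  rewrite /sx /paraboloid sumrB ex -mulr_sumr -enorm_sqr.
  have : l ^+ 2 / (4 * s1) / 2 * enorm x ^+ 2 <= l * enorm x / 2.
    rewrite el in l0 l1.
    rewrite (_ : _ * _ = l * enorm x / 2 * (l * enorm x / (4 * s1))); last first.
      by field; exact: lt0r_neq0.
    apply: ler_piMr; first by rewrite divr_ge0// mulr_ge0// ltW.
    rewrite ler_pdivrMr ?mulr_gt0// mul1r.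
    have : l * enorm x <= 1 * enorm x by rewrite ler_wpM2r.
    by rewrite /s1; lra.
  lra.
have k10 := profile_gt0 al s1.
rewrite pospow0; last first.
  by rewrite /slack; have := profile_nincr (ltW al0) sxl; lra.
rewrite mulr0 add0r divfK ?lt0r_neq0//.
have := HS _ s1S; rewrite ler_pdivlMr// => HS1; lra.
Qed.

Theorem theorem1p1 (R : realType) (N : nat) (p q theta C : R)
    (u0 : 'rV[R]_N -> R) (u : R -> 'rV[R]_N -> R)
    (hN : (1 <= N)%N)
    (hpc : 2 * N%:R / (N%:R + 1) < p) (hp2 : p <= 2)
    (hq0 : 0 < q) (hqp : q < p - 1)
    (hu0W : W1oo u0)
    (hu0_ge0 : forall x, 0 <= u0 x)
    (hu0_neq0 : exists x, u0 x != 0)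
    (hC : 0 < C) (htheta : q / (1 - q) < theta)
    (hu0_decay : forall x, u0 x <= C * (1 + enorm x) `^ (- theta))
    (hu : solution p q u0 u) :
  [/\ (forall t, 0 < t -> bounded_set (positivity_set u t)),
      (forall tau, 0 < tau -> exists rho, 0 < rho /\
         forall t, tau <= t -> positivity_set u t `<=` eball 0 rho) &
      (exists Te, 0 < Te /\ forall t, Te <= t -> forall x, u t x = 0)].
Proof.
have q1 : 0 < 1 - q by lra.
have th0 : 0 < theta by apply: lt_trans htheta; rewrite divr_gt0.
have pq : 0 < p - 1 - q by lra.
have del0 : 0 < 1 - q - q / theta.
  by rewrite subr_gt0 ltr_pdivrMr// mulrC -ltr_pdivrMr.
(* The exponent n = j + 3 has to be large for three reasons: al = theta / n <= 1,
   and the two conditions that let absorption dominate. *)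
pose X := (p - 1 - q)^-1 + theta + (1 - q - q / theta)^-1.
have X1 : 0 < (p - 1 - q)^-1 by rewrite invr_gt0.
have X2 : 0 < (1 - q - q / theta)^-1 by rewrite invr_gt0.
have [j jX] : exists j : nat, X <= j%:R.
  exists (Num.Def.archi_bound X); apply/ltW/archi_boundP.
  by rewrite /X; lra.
have j2 : j.+2%:R = j%:R + 2 :> R by rewrite -addn2 natrD.
have j3 : j.+3%:R = j%:R + 3 :> R by rewrite -addn3 natrD.
have j30 : 0 < j.+3%:R :> R by rewrite ltr0n.
pose al := theta / j.+3%:R.
have al0 : 0 < al by rewrite divr_gt0.
have al1 : al <= 1 by rewrite ler_pdivrMr// j3; move: jX; rewrite /X; lra.
have jd : 1 <= j.+2%:R * (p - 1 - q).
  by rewrite -ler_pdivrMr// div1r j2; move: jX; rewrite /X; lra.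
have ja : (1 + al^-1) * q <= j.+2%:R * (1 - q).
  have H : 1 <= j.+3%:R * (1 - q - q / theta).
    by rewrite -ler_pdivrMr// div1r j3; move: jX; rewrite /X; lra.
  have -> : (1 + al^-1) * q = q + j.+3%:R * (q / theta).
    by rewrite /al; field; rewrite !lt0r_neq0.
  by move: H; rewrite j2 j3; lra.
have [Mb uMb] := sol_bounded hu.
pose M := 2 `^ theta * C + `|Mb|.
have M1 : 0 < 2 `^ theta * C by rewrite mulr_gt0// powR_gt0.
have M0 : 0 < M by rewrite ltr_wpDr.
have uM t x : 0 <= t -> u t x <= M.
  move=> /(uMb _ x) H; have := ler_norm (u t x); have := ler_norm Mb.
  by rewrite /M; lra.
have uin x : u0 x <= M * profile al (enorm x) ^+ j.+3.
  apply: le_trans (hu0_decay x) _.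
  apply: le_trans (decay_le_profile j.+2 hC th0 (enorm_ge0 x)) _.
  apply: ler_wpM2r; last by rewrite /M lerDl.
  exact/exprn_ge0/ltW/profile_gt0.
(* The length l of e is chosen for the diffusion, and then the speed c of the
   clock for the decay. *)
have [l [l0 l1 lsm]] : exists l, [/\ 0 < l, l <= 1 &
    (4 * (M * j.+3%:R)) `^ (p - 1 - q) * (2 * l) `^ (p - q) *
      (4 * j.+2%:R + 3) <= 1 / 2].
  pose Z := (4 * (M * j.+3%:R)) `^ (p - 1 - q) * (4 * j.+2%:R + 3).
  have Z0 : 0 < Z by rewrite mulr_gt0// powR_gt0// !mulr_gt0.
  pose y := ((2 * Z)^-1) `^ ((p - q)^-1).
  have y0 : 0 < y by rewrite powR_gt0// invr_gt0 mulr_gt0.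
  have ppq : 0 < p - q by lra.
  exists (Num.min 1 (y / 2)); split.
  - by rewrite lt_min ltr01 divr_gt0.
  - by rewrite ge_min lexx.
  - have : (2 * Num.min 1 (y / 2)) `^ (p - q) <= (2 * Z)^-1.
      have -> : (2 * Z)^-1 = y `^ (p - q).
        rewrite /y -powRrM mulVf ?lt0r_neq0// powRr1// invr_ge0 mulr_ge0//.
        exact: ltW.
      apply: ge0_ler_powR; rewrite ?nnegrE ?(ltW ppq) ?(ltW y0)//.
        by rewrite mulr_ge0// le_min ler01 divr_ge0// ltW.
      by rewrite -ler_pdivlMl// mulrC ge_min lexx orbT.
    move=> /(ler_wpM2l (ltW Z0)).
    rewrite (_ : Z * (2 * Z)^-1 = 1 / 2); last by field; exact: lt0r_neq0.
    by apply: le_trans; rewrite /Z mulrAC.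
pose b := (2 * al / (1 + (4 `^ al^-1) ^+ 2) * (l / 2)) `^ q.
have Mj : 0 < (M * j.+3%:R) `^ (1 - q) by rewrite powR_gt0// mulr_gt0.
have b0 : 0 < b.
  rewrite powR_gt0// mulr_gt0//; last by rewrite divr_gt0.
  by rewrite divr_gt0 ?mulr_gt0// ltr_pwDl// exprn_ge0// powR_ge0.
pose c := b / (4 * (M * j.+3%:R) `^ (1 - q)).
have c0 : 0 < c by rewrite divr_gt0// mulr_gt0.
have csm : 4 * c * (M * j.+3%:R) `^ (1 - q) <= b.
  by rewrite le_eqVlt; apply/orP; left; apply/eqP; rewrite /c; field; exact: lt0r_neq0.
have van t x : 0 < t -> profile al (l * enorm x / 2) <= clock c t -> u t x = 0.
  exact: (solution_eq0 hN hu hp2 hq0 hqp al0 al1 jd ja M0 l0 l1 lsm c0 csm uM uin).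
have loc tau : 0 < tau -> exists rho, 0 < rho /\
    forall t, tau <= t -> positivity_set u t `<=` eball 0 rho.
  move=> tau0; have [S S0 HS] := profile_small al0 (clock_gt0 c0 tau0).
  exists (2 * S / l); split; first by rewrite divr_gt0// mulr_gt0.
  move=> t taut x; rewrite /positivity_set /eball /= subr0 ltNge => /negP upos.
  rewrite ltNge; apply/negP => xr; apply: upos.
  rewrite van ?(lt_le_trans tau0)//.
  have ctau := clock_ndecr (ltW c0) (ltW tau0) taut.
  apply: le_trans (HS _ _) ctau.
  by rewrite ler_pdivlMr// mulrC [l * _]mulrC -ler_pdivrMr.
split => //.
- move=> t t0; have [rho [rho0 Hrho]] := loc t t0.
  exists rho; split; first exact: num_real.
  move=> r rr x /(Hrho t (lexx t)); rewrite /eball /= subr0 => xr.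
  exact: le_trans (norm_le_enorm x) (ltW (lt_trans xr rr)).
- exists c^-1; split; first by rewrite invr_gt0.
  move=> t ct x; have t0 : 0 < t by rewrite (lt_le_trans _ ct)// invr_gt0.
  apply: van => //; apply: (@le_trans _ _ 1).
    rewrite -[leRHS](profile0 al); apply: profile_nincr; first exact: ltW.
    apply: divr_ge0 => //; apply: mulr_ge0; [exact: ltW|exact: enorm_ge0].
  have ct1 : 1 <= c * t by rewrite -ler_pdivrMl// mulr1.
  rewrite /clock lerBrDr -lerBrDl ler_pdivrMr; last by rewrite ltr_pwDl// (le_trans _ ct1).
  lra.
Qed.
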